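(* Let $\alpha\in(0,1)$, $T>0$, $N\in\mathbb{N}$, $\tau=T/N$, let $\kappa$ be the (constant) coefficient in the equations below, let $S>0$ be a stabilization constant, let $\Omega\subset\mathbb{R}^d$, $d\in\{1,2,3\}$, be a smooth domain with boundary $\partial\Omega$, and let $u_0$ be the given initial function. Put $E(u)=\int_\Omega\frac{\kappa^2}{2}|\nabla u(x)|^2+\frac14(1-u(x)^2)^2\,dx$. (a) The weighted convex splitting (WCS) scheme $$\bar\partial_\tau^\alpha u_n-\kappa^2\Delta u_n=u_{n,\alpha}-(u_n)^3\ \text{ in }\Omega,\qquad u_n=0\ \text{ on }\partial\Omega,\qquad 1\le n\le N,$$ satisfies the weighted energy stability unconditionally, i.e. $$E(u_n)\le E(u_{n,\alpha})\qquad\text{for all } n\ge1.$$ (b) The linear weighted stabilized (LWS) scheme $$\bar\partial_\tau^\alpha u_n-\kappa^2\Delta u_n=u_{n,\alpha}-(u_{n,\alpha})^3-S(u_n-u_{n,\alpha})\ \text{ in }\Omega,\qquad u_n=0\ \text{ on }\partial\Omega,\qquad 1\le n\le N,$$ also satisfies the weighted energy stability $E(u_n)\le E(u_{n,\alpha})$ for all $n\ge1$, under the constraint $S+\tau^{-\alpha}\ge2$.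
   Context: The schemes are time discretizations, with uniform step $\tau$ on $[0,T]$, of the time-fractional Allen-Cahn equation $\partial_t^\alpha u-\kappa^2\Delta u=u-u^3$ with homogeneous Dirichlet boundary condition and initial value $u_0$, where $\partial_t^\alpha u(x,t)=\frac{1}{\Gamma(1-\alpha)}\int_0^t(t-s)^{-\alpha}\partial_su(x,s)\,ds$ is the Caputo derivative. The backward Euler convolution quadrature is $\bar\partial_\tau^\alpha u_n=\tau^{-\alpha}\sum_{j=1}^n\omega_{n-j}(u_j-u_0)$, with $\omega_0=1$ and $\omega_j=(-1)^j\frac{\alpha(\alpha-1)\cdots(\alpha-j+1)}{j!}$ for $j\ge1$. The fractional extrapolation is $u_{n,\alpha}=u_n-\tau^\alpha\bar\partial_\tau^\alpha u_n=u_0-\sum_{j=1}^{n-1}\omega_{n-j}(u_j-u_0)$; it depends only on $u_0,\dots,u_{n-1}$ and is a convex combination of them. The schemes are discrete in time and continuous in space; given $u_0,\dots,u_{n-1}$, each is a uniquely solvable elliptic problem for $u_n$.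
   Formalization: The initial function u_0 is assumed to lie in H^1_0(Ω) (zero boundary values), and part (b) additionally assumes |u_0| ≤ 1 almost everywhere in Ω; without this bound (b) fails, e.g. for u_0 = A sin(πx) on (0,1) with A large. *)

(* Defs.v *)
From HB Require Import structures.
From mathcomp Require Import all_boot all_order all_algebra.
From mathcomp Require Import all_classical all_reals all_analysis.

Set Implicit Arguments.
Unset Strict Implicit.
Unset Printing Implicit Defensive.

Import Order.TTheory GRing.Theory Num.Theory.
Import numFieldNormedType.Exports.

Local Open Scope classical_set_scope.
Local Open Scope ring_scope.

(* The sigma-algebra of 'rV[T]_n is generated by the coordinates, as the
   library does for n.-tuple T; for T := R it is the Borel sigma-algebra. *)

Definition measure_rV_display : measure_display -> measure_display.
Proof. exact. Qed.

Section measurable_rV.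
Context {d} {T : sigmaRingType d}.
Variable n : nat.

Let coors : 'I_n -> 'rV[T]_n -> T := fun i x => x ord0 i.

Let rV_set0 : g_sigma_preimage coors set0.
Proof. exact: sigma_algebra0. Qed.

Let rV_setC A : g_sigma_preimage coors A -> g_sigma_preimage coors (~` A).
Proof. exact: sigma_algebraC. Qed.

Let rV_bigcup (F : _^nat) : (forall i, g_sigma_preimage coors (F i)) ->
  g_sigma_preimage coors (\bigcup_i (F i)).
Proof. exact: sigma_algebra_bigcup. Qed.

HB.instance Definition _ := @isMeasurable.Build (measure_rV_display d)
  'rV[T]_n (g_sigma_preimage coors) rV_set0 rV_setC rV_bigcup.

End measurable_rV.

Section measurable_rV_theory.
Context {d} {T : measurableType d}.

Lemma measurable_rV_coord n (i : 'I_n) :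
  measurable_fun [set: 'rV[T]_n] (fun x : 'rV[T]_n => x ord0 i).
Proof.
move=> _ Y mY; rewrite setTI; apply: sub_sigma_algebra => /=.
rewrite -bigcup_seq /=; exists i; first by rewrite /= mem_index_enum.
by exists Y => //; rewrite setTI.
Qed.

Lemma measurable_fun_rVP d' (U : measurableType d') n (f : U -> 'rV[T]_n) :
  (forall i, measurable_fun [set: U] (fun u => f u ord0 i)) ->
  measurable_fun [set: U] f.
Proof.
move=> mf; apply: (measurability (\big[setU/set0]_(i < n)
  preimage_set_system setT (fun x : 'rV[T]_n => x ord0 i) measurable)) => //.
move=> _ [C + <-]; rewrite -bigcup_seq => -[i _ [B mB <-]].
by rewrite !setTI; have := mf i measurableT B mB; rewrite setTI.
Qed.

End measurable_rV_theory.

(* Lebesgue measure on R^n, by Cavalieri's principle on the first coordinate *)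
Fixpoint lebesgue_rV (R : realType) (n : nat) : set 'rV[R]_n -> \bar R :=
  match n with
  | 0%N => fun A => dirac (0 : 'rV[R]_0) A
  | _.+1 => fun A => (\int[@lebesgue_measure R]_x
                        lebesgue_rV [set v | A (row_mx x%:M v)])%E
  end.

Section product_pushforward.
Context d1 d2 d3 (T1 : measurableType d1) (T2 : measurableType d2)
  (T3 : measurableType d3) (R : realType).
Variables (m1 : {sigma_finite_measure set T1 -> \bar R})
  (m2 : {sigma_finite_measure set T2 -> \bar R}).
Variables (f : T1 * T2 -> T3) (g : T3 -> T1 * T2).
Hypotheses (mf : measurable_fun setT f) (mg : measurable_fun setT g)
  (fK : cancel f g).

Definition product_pushforward := pushforward (m1 \x m2)%E f.

Local Notation m12 := product_pushforward.

Let mpre A : measurable A -> measurable (f @^-1` A).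
Proof. by move=> mA; rewrite -[X in measurable X]setTI; exact: mf. Qed.

Let m120 : m12 set0 = 0%E.
Proof. by rewrite /product_pushforward /pushforward preimage_set0 measure0. Qed.

Let m12_ge0 A : (0 <= m12 A)%E.
Proof. exact: measure_ge0. Qed.

Let m12_sigma_additive : semi_sigma_additive m12.
Proof.
move=> F mF tF mUF; rewrite /product_pushforward /pushforward preimage_bigcup.
apply: measure_semi_sigma_additive; [by move=> n; exact: mpre| |].
- apply/trivIsetP => i j _ _ ij; rewrite -preimage_setI.
  by move/trivIsetP : tF => /(_ _ _ _ _ ij) ->//; rewrite preimage_set0.
- by rewrite -preimage_bigcup; exact: mpre.
Qed.

HB.instance Definition _ := isMeasure.Build _ _ _ m12
  m120 m12_ge0 m12_sigma_additive.

Let m12_sigma_finite : sigma_finite setT m12.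
Proof.
have /sigma_finiteP[F [TF ndF Foo]] := sigma_finiteT m1.
have /sigma_finiteP[G [TG ndG Goo]] := sigma_finiteT m2.
exists (fun n => g @^-1` (F n `*` G n)) => [|k].
  rewrite -preimage_bigcup [X in g @^-1` X](_ : _ = setT) ?preimage_setT//.
  rewrite -subTset => -[x y] _.
  have [n _ Fn] : (\bigcup_n F n) x by rewrite -TF.
  have [k _ Gk] : (\bigcup_n G n) y by rewrite -TG.
  exists (maxn n k) => //; split.
    by move: x Fn; exact/subsetPset/ndF/leq_maxl.
  by move: y Gk; exact/subsetPset/ndG/leq_maxr.
have [? ?] := Foo k; have [? ?] := Goo k; split.
  by rewrite -[X in measurable X]setTI; apply: mg => //; exact: measurableX.
rewrite /product_pushforward /pushforward -comp_preimage (_ : g \o f = id); last first.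
  exact/funext/fK.
by rewrite preimage_id product_measure1E// lte_mul_pinfty// ge0_fin_numE.
Qed.

HB.instance Definition _ := Measure_isSigmaFinite.Build _ _ _ m12
  m12_sigma_finite.

Lemma sigma_finite_product_pushforward :
  exists m : {sigma_finite_measure set T3 -> \bar R},
    m = pushforward (m1 \x m2)%E f :> (set T3 -> \bar R).
Proof. by exists m12. Qed.

End product_pushforward.

Section lebesgue_rV_measure.
Variable R : realType.

Let glue n (p : R * 'rV[R]_n) : 'rV[R]_(n.+1) := row_mx p.1%:M p.2.
Let cut n (v : 'rV[R]_(n.+1)) : R * 'rV[R]_n :=
  (v ord0 ord0, \row_i v ord0 (lift ord0 i)).

Let mglue n : measurable_fun setT (@glue n).
Proof.
apply: measurable_fun_rVP => i.
rewrite /glue; have [j|j] := splitP (i : 'I_(1 + n)) => ij.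
- rewrite (_ : (fun _ => _) = fst) //; apply/funext => -[x v] /=.
  rewrite (_ : i = lshift n j); last exact/val_inj.
  by rewrite (row_mxEl x%:M v) mxE !ord1 eqxx mulr1n.
- rewrite (_ : (fun _ => _) = (fun w : 'rV[R]_n => w ord0 j) \o snd).
    by apply: measurableT_comp => //; exact: measurable_rV_coord.
  apply/funext => -[x v] /=.
  rewrite (_ : i = rshift 1 j); last exact/val_inj.
  by rewrite (row_mxEr x%:M v).
Qed.

Let mcut n : measurable_fun setT (@cut n).
Proof.
apply/measurable_fun_pairP; split => /=.
  exact: measurable_rV_coord.
apply: measurable_fun_rVP => i.
rewrite (_ : (fun _ => _) = (fun v : 'rV[R]_n.+1 => v ord0 (lift ord0 i))).
  exact: measurable_rV_coord.
by apply/funext => v; rewrite /= mxE.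
Qed.

Let glueK n : cancel (@glue n) (@cut n).
Proof.
move=> [x v]; rewrite /cut /glue /=; congr pair.
  rewrite (_ : ord0 = lshift n ord0 :> 'I_(1 + n)); last exact/val_inj.
  by rewrite (row_mxEl x%:M v) mxE eqxx mulr1n.
apply/rowP => i; rewrite mxE.
rewrite (_ : lift ord0 i = rshift 1 i :> 'I_(1 + n)); last exact/val_inj.
by rewrite (row_mxEr x%:M v).
Qed.

Let lebesgue_rV_ex n :
  exists m : {sigma_finite_measure set 'rV[R]_n -> \bar R},
    m = @lebesgue_rV R n :> (set 'rV[R]_n -> \bar R).
Proof.
elim: n => [|n [m mE]]; first by exists (dirac (0 : 'rV[R]_0)).
have [m' m'E] := sigma_finite_product_pushforward
  (@lebesgue_measure R) m (@mglue n) (@mcut n) (@glueK n).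
exists m'; rewrite m'E; apply/funext => A.
rewrite /pushforward /= /product_measure1 /=.
apply: eq_integral => x _ /=; rewrite mE.
congr (lebesgue_rV _); apply/funext => v /=.
by rewrite /xsection /= inE.
Qed.

Variable n : nat.
Let leb := @lebesgue_rV R n.

Let leb0 : leb set0 = 0%E.
Proof. by rewrite /leb; have [m <-] := lebesgue_rV_ex n; exact: measure0. Qed.

Let leb_ge0 A : (0 <= leb A)%E.
Proof. by rewrite /leb; have [m <-] := lebesgue_rV_ex n; exact: measure_ge0. Qed.

Let leb_sigma_additive : semi_sigma_additive leb.
Proof.
rewrite /leb; have [m <-] := lebesgue_rV_ex n.
exact: measure_semi_sigma_additive.
Qed.

HB.instance Definition _ := isMeasure.Build _ _ _ (@lebesgue_rV R n)
  leb0 leb_ge0 leb_sigma_additive.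

Let leb_sigma_finite : sigma_finite setT leb.
Proof. by rewrite /leb; have [m <-] := lebesgue_rV_ex n; exact: sigma_finiteT. Qed.

HB.instance Definition _ := Measure_isSigmaFinite.Build _ _ _ (@lebesgue_rV R n)
  leb_sigma_finite.

End lebesgue_rV_measure.

Section calculus.
Variables (R : realType) (d : nat).
Implicit Types (f phi : 'rV[R]_d -> R) (Omega : set 'rV[R]_d).

Definition partial (i : 'I_d) f : 'rV[R]_d -> R :=
  fun x => 'D_(delta_mx ord0 i) f x.

Definition laplacian f : 'rV[R]_d -> R :=
  fun x => \sum_(i < d) partial i (partial i f) x.

(* C^oo: all iterated partial derivatives exist and are continuous *)
Definition smooth f : Prop := forall s : seq 'I_d,
  let g := foldr partial f s in
  continuous g /\ forall i x, derivable g x (delta_mx ord0 i).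

(* C_c^oo(Omega), as functions extended by 0 outside Omega *)
Definition test_function Omega phi : Prop :=
  [/\ smooth phi, compact (closure [set x | phi x != 0])
    & closure [set x | phi x != 0] `<=` Omega].

(* Near each boundary point Omega is, up to a permutation and a reflection of
   the axes, the region strictly above the graph of a C^oo function gamma of
   the coordinates other than the i-th. *)
Definition smooth_boundary Omega : Prop :=
  forall x, (closure Omega `\` interior Omega) x ->
  exists (r : R) (i : 'I_d) (reflect : bool) (gamma : 'rV[R]_d -> R),
    [/\ 0 < r, smooth gamma,
        forall y z : 'rV[R]_d, (forall j, j != i -> y ord0 j = z ord0 j) ->
          gamma y = gamma z
      & forall y : 'rV[R]_d, ball x r y ->
          (Omega y <-> gamma y < (-1) ^+ reflect * y ord0 i)].

Definition smooth_domain Omega : Prop :=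
  [/\ open Omega, connected Omega, Omega !=set0 & smooth_boundary Omega].

End calculus.

Section sobolev.
Variables (R : realType) (d : nat) (Omega : set 'rV[R]_d).
Implicit Types (u g w phi : 'rV[R]_d -> R).

Local Notation mu := (@lebesgue_rV R d).

Definition L2 u : Prop := (u \_ Omega) \in Lfun mu 2%:E.

Definition L2_norm u : \bar R := Lnorm mu 2%:E (EFin \o (u \_ Omega)).

Definition is_weak_partial (i : 'I_d) u g : Prop :=
  forall phi, test_function Omega phi ->
    (\int[mu]_(x in Omega) (u x * partial i phi x)%:E =
     - \int[mu]_(x in Omega) (g x * phi x)%:E)%E.

Definition H1 u : Prop :=
  L2 u /\ forall i, exists2 g, L2 g & is_weak_partial i u g.

(* For u in H^1(Omega) this is the weak derivative of u, which is unique
   almost everywhere in Omega; for other u it may be the junk value 0. *)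
Definition weak_partial (i : 'I_d) u : 'rV[R]_d -> R :=
  xget (cst 0) [set g | L2 g /\ is_weak_partial i u g].

(* H^1_0(Omega): the closure of C_c^oo(Omega) in H^1(Omega) *)
Definition H10 u : Prop :=
  H1 u /\ exists phi : nat -> 'rV[R]_d -> R,
    [/\ forall k, test_function Omega (phi k),
        L2_norm (phi k \- u) @[k --> \oo] --> 0%E
      & forall i,
        L2_norm (partial i (phi k) \- weak_partial i u) @[k --> \oo] --> 0%E].

(* Delta u = w in Omega in the sense of distributions, with w in L^2(Omega) *)
Definition is_weak_laplacian u w : Prop :=
  L2 w /\ forall phi, test_function Omega phi ->
    (\int[mu]_(x in Omega) (u x * laplacian phi x)%:E =
     \int[mu]_(x in Omega) (w x * phi x)%:E)%E.

Definition energy (kappa : R) u : \bar R :=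
  (\int[mu]_(x in Omega)
    (kappa ^+ 2 / 2 * (\sum_(i < d) weak_partial i u x ^+ 2)
     + 1 / 4 * (1 - u x ^+ 2) ^+ 2)%:E)%E.

End sobolev.

Section schemes.
Variables (R : realType) (d : nat).
Variables (alpha tau : R).

(* omega_j = (-1)^j alpha (alpha - 1) ... (alpha - j + 1) / j!; omega_0 = 1 *)
Definition cq_weight (j : nat) : R :=
  (-1) ^+ j * (\prod_(i < j) (alpha - i%:R)) / j`!%:R.

(* backward Euler convolution quadrature of the Caputo derivative *)
Definition cq (u : nat -> 'rV[R]_d -> R) (n : nat) (x : 'rV[R]_d) : R :=
  tau `^ (- alpha) *
  \sum_(1 <= j < n.+1) cq_weight (n - j) * (u j x - u 0%N x).

Definition extrapolation (u : nat -> 'rV[R]_d -> R) (n : nat)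
    (x : 'rV[R]_d) : R :=
  u n x - tau `^ alpha * cq u n x.

(* The u n with 1 <= n <= N solve the scheme with right-hand side rhs: the
   boundary condition is u n \in H^1_0(Omega), and the equation holds almost
   everywhere in Omega, w being the Laplacian of u n. *)
Definition solves_scheme (Omega : set 'rV[R]_d) (kappa : R) (N : nat)
    (rhs : R -> R -> R) (u : nat -> 'rV[R]_d -> R) : Prop :=
  forall n, (1 <= n <= N)%N ->
    H10 Omega (u n) /\
    exists2 w, is_weak_laplacian Omega (u n) w &
      {ae @lebesgue_rV R d, forall x, Omega x ->
        cq u n x - kappa ^+ 2 * w x = rhs (u n x) (extrapolation u n x)}.

Definition WCS Omega kappa N u : Prop :=
  solves_scheme Omega kappa N (fun un v => v - un ^+ 3) u.

Definition LWS Omega kappa S N u : Prop :=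
  solves_scheme Omega kappa N (fun un v => v - v ^+ 3 - S * (un - v)) u.

End schemes.

(* Main.v *)
(** The scheme reads tau^(-alpha) (u - v) - kappa^2 w = f with u = u_n,
    v = u_(n,alpha) and w the weak Laplacian of u.  Pointwise convexity bounds
    the difference of the double-well potentials at u and v by
    kappa^2 w (u - v), and |grad u|^2 - |grad v|^2 <= 2 grad u . (grad u - grad v);
    Green's identity, int w z = - int grad u . grad z for z in H^1_0, makes the
    two integrated bounds cancel.

    For the linear scheme the pointwise bound needs |u|, |v| <= 1.  This is a
    maximum principle: c u - kappa^2 w = c v + v - v^3 with
    c = S + tau^(-alpha) >= 2 has a right-hand side bounded by c, v being a
    convex combination of earlier iterates.  Testing with eta_m(u), where
    eta_m(s) = s^(2m+1) / (1 + s^(2m)), avoids truncations in Sobolev spaces: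
    eta_m is increasing, smooth and vanishes at 0, so eta_m o phi is a test
    function if phi is, hence int w eta_m(u) <= 0 by density; letting m grow
    gives int |u| max(|u| - 1, 0) <= 0. *)
Require Import Defs.
From HB Require Import structures.
From mathcomp Require Import all_boot all_order all_algebra.
From mathcomp Require Import all_classical all_reals all_analysis.
From mathcomp Require Import measurable_realfun.
From mathcomp Require Import ring lra.

Set Implicit Arguments.
Unset Strict Implicit.
Unset Printing Implicit Defensive.

Import Order.TTheory GRing.Theory Num.Theory.
Import numFieldNormedType.Exports.

Local Open Scope classical_set_scope.
Local Open Scope ring_scope.

(** * Measure theory on R^d *)

Section rV_measurability.
Variables (R : realType) (d : nat).
Implicit Types A : set 'rV[R]_d.

Lemma ball_rVP (x y : 'rV[R]_d) (e : R) : 0 < e ->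
  ball x e y <-> forall i, `|x ord0 i - y ord0 i| < e.
Proof.
move=> e0; split=> [[_ h] i|h]; first exact: (h ord0 i).
by split=> // i j; rewrite ord1; exact: h.
Qed.

(** The sigma-algebra is generated by the coordinates, so an open set is exhibited as the union of
    the countably many cubes with rational centre and radius that it contains. *)
Lemma open_measurable_rV A : open A -> measurable A.
Proof.
move=> oA.
pose B (p : 'rV[rat]_d * rat) : set 'rV[R]_d :=
  [set y | forall i, `|ratr (p.1 ord0 i) - y ord0 i| < ratr p.2].
pose F p : set 'rV[R]_d := if `[< B p `<=` A >] then B p else set0.
have -> : A = \bigcup_p F p.
  apply/seteqP; split=> [x Ax|x [p _]]; last first.
    by rewrite /F; case: asboolP => // BA /BA.
  have /nbhs_ballP[e /= e0 eA] : nbhs x A by apply: open_nbhs_nbhs.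
  (* A radius below [e / 2] and a centre closer to [x] than this radius put [x] in the cube and the
     cube in the ball of radius [e] around [x]. *)
  have [r] := @rat_in_itvoo R 0 (e / 2) (divr_gt0 e0 (ltr0n _ 2)).
  rewrite in_itv /= => /andP[r0 re].
  have qP i : exists q : rat, `|ratr q - x ord0 i| < ratr r.
    have [|q] := @rat_in_itvoo R (x ord0 i - ratr r) (x ord0 i + ratr r).
      by rewrite ltrD2l gtrN.
    by rewrite in_itv /= => qx; exists q; rewrite ltr_distl.
  have [q qE] := choice qP.
  exists (\row_i q i, r) => //.
  rewrite /F; case: asboolP => [_ i|]; first by rewrite mxE; exact: qE.
  case=> y By; apply: eA; apply/ball_rVP => // i.
  have := By i; have := qE i; rewrite mxE /= => h1 h2.
  rewrite (_ : x ord0 i - y ord0 i =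
      (ratr (q i) - y ord0 i) - (ratr (q i) - x ord0 i)); last by ring.
  by apply: (le_lt_trans (ler_normB _ _)); lra.
apply: countable_bigcupT_measurable => [|p].
  exact: countableP.
rewrite /F; case: asboolP => // _.
rewrite (_ : B p = \bigcap_(i in [set: 'I_d])
    [set y | `|ratr (p.1 ord0 i) - y ord0 i| < ratr p.2]); last first.
  by apply/seteqP; split=> y h i; [move=> _; exact: h|exact: h i I].
apply: fin_bigcap_measurable => // i _.
have mf : measurable_fun setT (fun y : 'rV[R]_d => `|ratr (p.1 ord0 i) - y ord0 i|).
  apply: measurableT_comp => //; apply: measurable_funB => //.
  exact: measurable_rV_coord.
have /(_ _ (measurable_itv `]-oo, ratr p.2[)) := mf measurableT.
by rewrite setTI.
Qed.

Lemma continuous_measurable_rV (f : 'rV[R]_d -> R) : continuous f ->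
  measurable_fun setT f.
Proof.
move=> /continuousP cf.
apply: (measurability _ (RGenOpens.measurableE R)) => //.
move=> _ [_ [a [b ->] <-]]; rewrite setTI.
by apply: open_measurable_rV; apply: cf; exact: interval_open.
Qed.

End rV_measurability.

(** * Boxes have finite measure *)

Section rV_finiteness.
Variable R : realType.

(** Induction on the dimension: the slice at first coordinate x is the box of one dimension less if
    |x| <= M and empty otherwise, so the measure is a product of two finite factors. *)
Lemma lebesgue_rV_box_lty d (M : R) :
  (@lebesgue_rV R d [set x : 'rV[R]_d | forall i, (`|x ord0 i| <= M)%R] < +oo)%E.
Proof.
elim: d => [|d IH].
  rewrite /= diracE; case: (_ \in _) => /=; exact: ltry.
rewrite /=.
set B := [set x : 'rV[R]_d | forall i, `|x ord0 i| <= M] in IH *.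
rewrite [ltLHS](_ : _ = \int[@lebesgue_measure R]_x
    (cst (@lebesgue_rV R d B) \_ [set` `[- M, M]%R]) x)%E; last first.
  apply: eq_integral => x _.
  rewrite patchE; case: ifPn => [|]; rewrite mem_setE in_itv /= => xM.
    congr (lebesgue_rV _); apply/seteqP; split=> v /= h i.
      have := h (rshift 1 i).
      by rewrite (row_mxEr x%:M v).
    have [j|j] := splitP (i : 'I_(1 + d)) => ij.
      rewrite (_ : i = lshift d j); last exact/val_inj.
      by rewrite (row_mxEl x%:M v) mxE !ord1 eqxx mulr1n ler_norml.
    rewrite (_ : i = rshift 1 j); last exact/val_inj.
    by rewrite (row_mxEr x%:M v).
  rewrite (_ : [set v | _] = set0) ?measure0//.
  apply/seteqP; split=> v //= /(_ (lshift d (@ord0 0))).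
  by rewrite (row_mxEl x%:M v) mxE eqxx mulr1n ler_norml (negbTE xM).
rewrite -integral_mkcond integral_cst //=.
rewrite lebesgue_measure_itv /=.
case: ifPn => _; last by rewrite mule0 ltry.
by rewrite lte_mul_pinfty// ?ge0_fin_numE// -EFinB ltry.
Qed.

Lemma measurable_rV_box d (M : R) :
  measurable [set x : 'rV[R]_d | forall i, `|x ord0 i| <= M].
Proof.
rewrite (_ : [set x | _] = \bigcap_(i in [set: 'I_d])
    [set x : 'rV[R]_d | `|x ord0 i| <= M]); last first.
  by apply/seteqP; split=> y h i; [move=> _; exact: h|exact: h i I].
apply: fin_bigcap_measurable => // i _.
have mf : measurable_fun setT (fun y : 'rV[R]_d => `|y ord0 i|).
  by apply: measurableT_comp => //; exact: measurable_rV_coord.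
have /(_ _ (measurable_itv `]-oo, M])) := mf measurableT.
by rewrite setTI.
Qed.

Lemma compact_sub_box d (K : set 'rV[R]_d) : compact K ->
  exists M : R, K `<=` [set x | forall i, `|x ord0 i| <= M].
Proof.
move=> /compact_bounded[M [_ MK]]; exists (M + 1) => x Kx i.
have := MK (M + 1); rewrite ltrDl ltr01 => /(_ isT _ Kx).
apply: le_trans.
rewrite [leRHS](_ : _ = mx_norm x) // mx_normrE.
exact: (le_bigmax _ (fun ij => `|x ij.1 ij.2|) (ord0, i)).
Qed.

End rV_finiteness.

(** * The space L^2(Omega) *)

Section finite_sums.
Context d (T : measurableType d) (R : realType) (mu : {measure set T -> \bar R}).
Variables (A : set T) (I : Type) (r : seq I) (f : I -> T -> R).
Hypotheses (mA : measurable A) (If : forall i, mu.-integrable A (EFin \o f i)).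

Lemma integrable_sum_EFin :
  mu.-integrable A (EFin \o (fun x => \sum_(i <- r) f i x)).
Proof.
rewrite (_ : _ \o _ = fun x => (\sum_(i <- r) (f i x)%:E)%E).
  by apply: integrable_sum => // i _; exact: If.
by apply/funext => x; rewrite /= sumEFin.
Qed.

Lemma Rintegral_sum :
  \int[mu]_(x in A) (\sum_(i <- r) f i x) = \sum_(i <- r) \int[mu]_(x in A) f i x.
Proof.
rewrite /Rintegral sum_fine => [|i _]; last exact: (integrable_fin_num mA (If i)).
congr fine; rewrite -integral_sum //; apply: eq_integral => x _.
by rewrite sumEFin.
Qed.

End finite_sums.

Section L2_theory.
Variables (R : realType) (d : nat) (Omega : set 'rV[R]_d).
Hypothesis mO : measurable Omega.
Implicit Types f g u v : 'rV[R]_d -> R.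
Local Notation mu := (@lebesgue_rV R d).
Local Notation L2 := (L2 Omega).
Local Notation L2_norm := (L2_norm Omega).

Lemma L2_measurable u : L2 u -> measurable_fun Omega u.
Proof.
rewrite /Defs.L2 => /sub_Lfun_mfun; rewrite inE /= => mu_.
exact/(measurable_restrictT _ mO).
Qed.

Lemma L2_lincomb (a b : R) u v : L2 u -> L2 v ->
  L2 (fun x => a * u x + b * v x).
Proof.
rewrite /Defs.L2 => Lu Lv.
rewrite (_ : _ \_ _ = a *: (u \_ Omega) + b *: (v \_ Omega)).
  have [L0 LD] := @Lfun_submod_closed _ _ _ mu _ (lee1n 2).
  by rewrite -[b *: _]addr0; do 2 apply: (LD _ _ _ _ _) => //.
apply/funext => x; rewrite /GRing.add /GRing.scale /= !patchE.
by case: ifP => // _; rewrite !scaler0 addr0.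
Qed.

Lemma L2M_integrable u v : L2 u -> L2 v ->
  mu.-integrable Omega (EFin \o (fun x => u x * v x)).
Proof.
move=> Lu Lv; apply/(integrable_mkcond _ mO).
rewrite (_ : _ \_ Omega = EFin \o ((u \_ Omega) \* (v \_ Omega))).
  exact/Lfun1_integrable/Lfun2_mul_Lfun1.
apply/funext => x; rewrite /= !patchE.
by case: ifP => // _; rewrite mulr0.
Qed.

Lemma L2_norm_fin u : L2 u -> L2_norm u \is a fin_num.
Proof.
rewrite /Defs.L2 /Defs.L2_norm => /sub_Lfun_finLfun; rewrite inE /= /finite_norm => h.
by rewrite ge0_fin_numE ?Lnorm_ge0.
Qed.

Lemma L2_cauchy_schwarz u v : L2 u -> L2 v ->
  `|\int[mu]_(x in Omega) (u x * v x)| <= fine (L2_norm u) * fine (L2_norm v).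
Proof.
move=> Lu Lv.
have /sub_Lfun_mfun := Lu; rewrite inE /= => mfu.
have /sub_Lfun_mfun := Lv; rewrite inE /= => mfv.
rewrite -lee_fin EFinM !fineK ?L2_norm_fin //.
have h2 : (2^-1 + 2^-1 = 1 :> R)%R by rewrite -div1r -splitr.
apply: (le_trans _ (hoelder mu mfu mfv (ltr0n _ 2) (ltr0n _ 2) h2)).
rewrite Lnorm1 EFin_normr_Rintegral //; last exact: L2M_integrable.
apply: (le_trans (le_abse_integral _ _ _)) => //.
  exact: (measurable_int mu (L2M_integrable Lu Lv)).
rewrite integral_mkcond le_eqVlt; apply/orP; left; apply/eqP.
apply: eq_integral => x _; rewrite /= !patchE.
by case: ifP => // _; rewrite mulr0 normr0.
Qed.

(** Norm convergence implies weak convergence, by Cauchy-Schwarz. The later limits along test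
    functions go through this. *)
Lemma L2_cvg_Rintegral (f_ : nat -> 'rV[R]_d -> R) f g :
  (forall k, L2 (f_ k)) -> L2 f -> L2 g ->
  L2_norm (f_ k \- f) @[k --> \oo] --> 0%E ->
  \int[mu]_(x in Omega) (f_ k x * g x) @[k --> \oo] -->
    \int[mu]_(x in Omega) (f x * g x).
Proof.
move=> Lf_ Lf Lg cf.
have LB k : L2 (f_ k \- f).
  rewrite (_ : _ \- _ = fun x => 1 * f_ k x + (-1) * f x).
    exact: L2_lincomb.
  by apply/funext => x /=; rewrite mul1r mulN1r.
have cn : fine (L2_norm (f_ k \- f)) * fine (L2_norm g) @[k --> \oo] --> (0 : R).
  rewrite -(mul0r (fine (L2_norm g))); apply: cvgMl.
  exact: fine_cvg.
apply/cvgrPdist_le => e e0.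
move/cvgrPdist_le : cn => /(_ e e0); apply: filterS => k.
rewrite sub0r normrN; apply: le_trans.
rewrite distrC -RintegralB //; [|exact: L2M_integrable..].
under eq_Rintegral do rewrite -mulrBl.
exact/(le_trans (L2_cauchy_schwarz (LB k) Lg))/ler_norm.
Qed.

(** [f] is assumed measurable rather than in L^2, so that the bound can prove membership in L^2 as
    well as norm convergence. *)
Lemma L2_norm_le f g (c : R) : L2 g -> measurable_fun Omega f -> 0 <= c ->
  (forall x, Omega x -> `|f x| <= c * `|g x|) ->
  (L2_norm f <= c%:E * L2_norm g)%E.
Proof.
move=> Lg mf c0 fg; have mg := L2_measurable Lg.
have mfO := (measurable_restrictT f mO).1 mf.
have mgO := (measurable_restrictT g mO).1 mg.
have cE : c%:E = `|c|%:E by rewrite ger0_norm.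
have := LnormZ (Lfun_Sub (lee1n 2) Lg) c.
rewrite cE /Defs.L2_norm /= => <-.
rewrite unlock /=.
have ge0 (h : 'rV[R]_d -> R) : (\int[mu]_x (`|h x| `^ 2)%:E \in `[0, +oo])%E.
  by rewrite in_itv /= leey andbT; apply: integral_ge0 => x _; rewrite lee_fin powR_ge0.
have p0 : (0 <= 2^-1 :> R)%R by rewrite invr_ge0.
apply: (gt0_ler_poweR p0 (ge0 _) (ge0 (c \*: (g \_ Omega)))).
apply: ge0_le_integral => //.
- apply/measurable_EFinP.
  apply: (measurableT_comp (measurable_powR 2)).
  exact: measurableT_comp.
- apply/measurable_EFinP.
  apply: (measurableT_comp (measurable_powR 2)).
  by apply: measurableT_comp => //; exact: measurable_funM.
move=> x _; rewrite lee_fin ge0_ler_powR ?nnegrE //.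
rewrite normrZ (ger0_norm c0) !patchE.
case: ifPn => [|_]; last by rewrite normr0 mulr0.
by rewrite inE => /fg.
Qed.

Lemma L2_dominated f g (c : R) : L2 g -> measurable_fun Omega f -> 0 <= c ->
  (forall x, Omega x -> `|f x| <= c * `|g x|) -> L2 f.
Proof.
move=> Lg mf c0 fg; rewrite /Defs.L2 inE; apply/andP; split; rewrite inE /=.
  exact/(measurable_restrictT f mO).
apply: le_lt_trans (L2_norm_le Lg mf c0 fg) _.
by rewrite lte_mul_pinfty // -ge0_fin_numE ?L2_norm_fin ?Lnorm_ge0.
Qed.

Lemma finite_sqr_L2 f : measurable_fun Omega f ->
  (\int[mu]_(x in Omega) (f x ^+ 2)%:E < +oo)%E -> L2 f.
Proof.
move=> mf foo; have mfO := (measurable_restrictT f mO).1 mf.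
rewrite /Defs.L2 inE; apply/andP; split; rewrite inE //= /finite_norm unlock.
rewrite poweR_lty //; apply: le_lt_trans foo.
rewrite [leRHS]integral_mkcond le_eqVlt; apply/orP; left; apply/eqP.
apply: eq_integral => x _; rewrite /= !patchE; case: ifP => _.
  by rewrite powR_mulrn // real_normK // num_real.
by rewrite normr0 powR0.
Qed.

End L2_theory.

(** * Smooth functions and test functions *)

Section smooth_functions.
Variables (R : realType) (d : nat).
Implicit Types f g phi : 'rV[R]_d -> R.
Local Notation e_ i := (delta_mx ord0 i : 'rV[R]_d).

(** Smoothness graded by order: recursion on the order suits inductions through the product and
    quotient rules better than lists of indices. *)
Fixpoint Cn n f : Prop := match n with
  | 0%N => continuous f
  | k.+1 => [/\ continuous f, forall i x, derivable f x (e_ i)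
              & forall i, Cn k (partial i f)]
  end.

Lemma CnW n f : Cn n.+1 f -> Cn n f.
Proof.
elim: n f => [f []//|n IH f [cf df pf]]; split=> // i.
exact/IH/pf.
Qed.

Lemma smoothP f : smooth f <-> forall n, Cn n f.
Proof.
split=> [sf n|cf s].
  elim: n f sf => [f sf|n IH f sf]; first by have [] := sf [::].
  have [? ?] := sf [::]; split=> // i; apply: IH => s.
  by have := sf (rcons s i); rewrite foldr_rcons.
elim/last_ind: s f cf => [f cf|s i IH f cf].
  by have [] := cf 1%N.
by rewrite foldr_rcons; apply: IH => n; have [_ _ /(_ i)] := cf n.+1.
Qed.

Lemma Cn_cst n (a : R) : Cn n (cst a).
Proof.
elim: n a => [a|n IH a] /=; first by move=> ?; exact: cst_continuous.
split=> [|i x|i]; [by move=> ?; exact: cst_continuous|exact: derivable_cst|].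
rewrite (_ : partial i (cst a) = cst 0); first exact: IH.
by apply/funext => x; rewrite /partial derive_cst.
Qed.

Lemma CnD n f g : Cn n f -> Cn n g -> Cn n (f \+ g).
Proof.
elim: n f g => [f g cf cg x|n IH f g [cf df pf] [cg dg pg]].
  by apply: continuousD; [exact: cf|exact: cg].
split=> [x|i x|i]; first by apply: continuousD; [exact: cf|exact: cg].
  by apply: derivableD; [exact: df|exact: dg].
rewrite (_ : partial i _ = partial i f \+ partial i g).
  by apply: IH; [exact: pf|exact: pg].
by apply/funext => x; apply: deriveD; [exact: df|exact: dg].
Qed.

Lemma CnM n f g : Cn n f -> Cn n g -> Cn n (f \* g).
Proof.
elim: n f g => [f g cf cg x|n IH f g cnf cng].
  by apply: continuousM; [exact: cf|exact: cg].
have [cf df pf] := cnf; have [cg dg pg] := cng.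
split=> [x|i x|i]; first by apply: continuousM; [exact: cf|exact: cg].
  by apply: derivableM; [exact: df|exact: dg].
rewrite (_ : partial i _ = (f \* partial i g) \+ (g \* partial i f)).
  by apply: CnD; apply: IH; [exact: CnW|exact: pg|exact: CnW|exact: pf].
by apply/funext => x; apply: deriveM; [exact: df|exact: dg].
Qed.

Lemma CnV n f : (forall x, f x != 0) -> Cn n f -> Cn n (fun x => (f x)^-1).
Proof.
move=> f0; elim: n => [|n IH] cnf.
  by move=> x; apply: continuousV => //; exact: cnf.
have [cf df pf] := cnf; have Vn := IH (CnW cnf).
split=> [x|i x|i]; first by apply: continuousV => //; exact: cf.
  by apply: derivableV => //; exact: df.
(* The derivative of 1/f is written as a product in 1/f itself, to which the induction hypothesis
   applies. *)
rewrite (_ : partial i _ = (cst (-1) \* ((fun x => (f x)^-1) \*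
    (fun x => (f x)^-1))) \* partial i f).
  by apply: CnM (pf i); apply: CnM (Cn_cst _ _) _; exact: CnM.
apply/funext => x; rewrite /partial deriveV //= /GRing.scale /=.
by rewrite expr2 invfM mulN1r.
Qed.

Lemma CnX n k f : Cn n f -> Cn n (fun x => f x ^+ k).
Proof.
move=> cf; elim: k => [|k IH].
  by rewrite (_ : (fun _ => _) = cst 1); [exact: Cn_cst|apply/funext => x].
rewrite (_ : (fun _ => _) = f \* (fun x => f x ^+ k)); first exact: CnM.
by apply/funext => x; rewrite exprS.
Qed.

End smooth_functions.

(** * Smooth truncations *)

Section cutoff.
Variable R : realType.

(* eta_m(s) tends to s on |s| > 1 and to 0 on |s| < 1 as m grows: a smooth
   substitute for the truncation s - max(-1, min(s, 1)). *)
Definition cutoff m (s : R) : R := s ^+ m.*2.+1 / (1 + s ^+ m.*2).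

(** The derivative of [cutoff m], in a form that shows its sign and the bound 2m + 1. *)
Definition cutoff' m (s : R) : R :=
  s ^+ m.*2 * (m.*2.+1%:R + s ^+ m.*2) / (1 + s ^+ m.*2) ^+ 2.

Lemma even_exp_ge0 m (s : R) : 0 <= s ^+ m.*2.
Proof. by rewrite exprn_even_ge0 // odd_double. Qed.

Lemma even_exp1_gt0 m (s : R) : 0 < 1 + s ^+ m.*2.
Proof. by rewrite ltr_pwDl // even_exp_ge0. Qed.

(** Directions in a normed space cover both the one-variable derivative and the partial derivatives
    of a truncated test function. *)
Lemma is_derive_cutoff (V : normedModType R) m (f : V -> R) (x v : V) :
  derivable f x v ->
  is_derive x v (cutoff m \o f) (cutoff' m (f x) * 'D_v f x).
Proof.
move=> df; have q0 := even_exp1_gt0 m (f x).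
pose g := cst 1 + f ^+ m.*2.
have gE y : g y = 1 + f y ^+ m.*2 by rewrite /g /GRing.add /= fctE.
have dg : derivable g x v by apply: derivableD => //; exact: derivableX.
have g0 : g x != 0 by rewrite gE gt_eqF.
have -> : cutoff m \o f = (f ^+ m.*2.+1) * (fun y => (g y)^-1).
  by apply/funext => y; rewrite /= /cutoff /GRing.mul /= gE fctE.
split.
  by apply: derivableM; [exact: derivableX|exact: derivableV].
rewrite deriveM; [|exact: derivableX|exact: derivableV].
rewrite deriveV // deriveX // deriveD //; last exact: derivableX.
rewrite derive_cst deriveX // gE fctE /cutoff' /GRing.scale /= add0r.
(* The exponents add up to 4m; for m = 0 the predecessor is truncated, but the coefficient 2m
   vanishes. *)
have key : m.*2%:R * (f x ^+ m.*2.+1 * f x ^+ m.*2.-1) =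
    m.*2%:R * (f x ^+ m.*2) ^+ 2.
  by case: (m) => [|k]; rewrite ?mul0r // doubleS /= !exprS; ring.
move: q0 key; rewrite -[m.*2.+1%:R]natr1.
move: (f x ^+ _.+1) (f x ^+ _.-1) (f x ^+ _) (m.*2%:R) ('D_v f x) => s1 s2 q c D q0 key.
have q1 : 1 + q != 0 by rewrite gt_eqF.
transitivity (((c + 1) * q * (1 + q) - c * (s1 * s2)) / (1 + q) ^+ 2 * D).
  by field.
by rewrite key; congr (_ / _ * _); ring.
Qed.

Lemma is_derive1_cutoff m (x : R) :
  is_derive x (1 : R) (cutoff m) (cutoff' m x).
Proof.
have di : derivable (@id R) x (1 : R) by exact: derivable_id.
by have := is_derive_cutoff m di; rewrite derive_id mulr1.
Qed.

Lemma continuous_cutoff m : continuous (cutoff m).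
Proof.
move=> x; apply: differentiable_continuous.
by apply/derivable1_diffP; have [] := is_derive1_cutoff m x.
Qed.

Lemma cutoff'_ge0 m s : 0 <= cutoff' m s.
Proof.
rewrite divr_ge0 ?mulr_ge0 ?addr_ge0 ?even_exp_ge0 //.
Qed.

Lemma cutoff'_le m s : cutoff' m s <= m.*2.+1%:R.
Proof.
rewrite ler_pdivrMr ?exprn_gt0 ?even_exp1_gt0 //.
have := even_exp_ge0 m s; move: (s ^+ _) => q q0.
have : 1 <= m.*2.+1%:R :> R by rewrite ler1n.
move: (m.*2.+1%:R) => c c1; nra.
Qed.

(** Mean value theorem with 0 <= [cutoff'] <= 2m + 1. The constant grows with m, but m stays fixed
    in each limit along test functions. *)
Lemma cutoff_lipschitz m s t : `|cutoff m s - cutoff m t| <= m.*2.+1%:R * `|s - t|.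
Proof.
wlog ts : s t / t <= s.
  move=> h; case/orP: (le_total t s) => /h //.
  by rewrite distrC (distrC t).
have cc : {within `[t, s], continuous (cutoff m)}.
  by apply: continuous_subspaceT; exact: continuous_cutoff.
have [c _ ->] := MVT_segment ts (fun x _ => is_derive1_cutoff m x) cc.
by rewrite normrM ler_wpM2r // ger0_norm ?cutoff'_ge0 // cutoff'_le.
Qed.

Lemma cutoff0 m : cutoff m 0 = 0.
Proof. by rewrite /cutoff exprS !mul0r. Qed.

End cutoff.

(** * Stability and integrability of test functions *)

Section test_functions.
Variables (R : realType) (d : nat) (Omega : set 'rV[R]_d).
Hypothesis mO : measurable Omega.
Implicit Types f g phi : 'rV[R]_d -> R.
Local Notation mu := (@lebesgue_rV R d).

Lemma smooth_cutoff m phi : smooth phi -> smooth (cutoff m \o phi).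
Proof.
move=> /smoothP cphi; apply/smoothP => n.
rewrite (_ : _ \o _ = (fun x => phi x ^+ m.*2.+1) \*
    (fun x => ((cst 1 \+ (fun x => phi x ^+ m.*2)) x)^-1)) //.
apply: CnM; first exact: CnX.
apply: CnV => [x|]; first by rewrite gt_eqF //=; exact: even_exp1_gt0.
by apply: CnD; [exact: Cn_cst|exact: CnX].
Qed.

Lemma smooth_partial i phi : smooth phi -> smooth (partial i phi).
Proof. by move=> sphi s; have := sphi (rcons s i); rewrite foldr_rcons. Qed.

Lemma test_function_closure phi psi : test_function Omega phi -> smooth psi ->
  [set x | psi x != 0] `<=` closure [set x | phi x != 0] ->
  test_function Omega psi.
Proof.
move=> [sphi cphi phiO] spsi sub.
have csub : closure [set x | psi x != 0] `<=` closure [set x | phi x != 0].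
  have /closure_id E := @closed_closure _ [set x | phi x != 0].
  rewrite E.
  exact: closureS.
split=> //; last exact: subset_trans phiO.
by apply: subclosed_compact cphi csub; exact: closed_closure.
Qed.

Lemma test_function_partial i phi :
  test_function Omega phi -> test_function Omega (partial i phi).
Proof.
move=> tphi; have [sphi _ _] := tphi.
apply: test_function_closure tphi (smooth_partial i sphi) _.
move=> x /=; apply: contraNP => xphi; apply/eqP.
(* Off its closed support [phi] vanishes near [x], so its derivative is that of the zero
   function. *)
rewrite /partial -(derive_cst (0 : R) x (delta_mx ord0 i)).
apply: near_eq_derive.
have : nbhs x (~` closure [set x | phi x != 0]).
  by apply: open_nbhs_nbhs; split => //; apply: closed_openC; exact: closed_closure.
apply: filterS => y yphi; apply/eqP; apply: contra_notT yphi => yphi.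
exact: subset_closure.
Qed.

Lemma test_function_cutoff m phi :
  test_function Omega phi -> test_function Omega (cutoff m \o phi).
Proof.
move=> tphi; have [sphi _ _] := tphi.
apply: test_function_closure tphi (smooth_cutoff m sphi) _.
move=> x /= cx; apply: subset_closure; apply: contra_neq cx => /= ->.
exact: cutoff0.
Qed.

Lemma test_function_continuous phi : test_function Omega phi -> continuous phi.
Proof. by move=> [/(_ [::])[]]. Qed.

Lemma test_function_derivable phi i x : test_function Omega phi ->
  derivable phi x (delta_mx ord0 i).
Proof. by move=> [/(_ [::])[]]. Qed.

Lemma L2_indic (A : set 'rV[R]_d) : measurable A -> (mu A < +oo)%E ->
  L2 Omega (\1_A).
Proof.
move=> mA Aoo; apply: finite_sqr_L2 => //.
apply: le_lt_trans Aoo.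
rewrite (eq_integral (fun x => (\1_A x)%:E)) => [|x _]; last first.
  by rewrite indicE expr2 -natrM mulnb andbb.
rewrite integral_indic //; apply: le_measure; rewrite ?inE //.
exact: measurableI.
Qed.

(** A test function is bounded on its compact support, which lies in a box of finite measure, so a
    multiple of the indicator of that box dominates it. *)
Lemma test_function_L2 phi : test_function Omega phi -> L2 Omega phi.
Proof.
move=> tphi; have [sphi cphi _] := tphi.
have [M KM] := compact_sub_box cphi.
have cont := test_function_continuous tphi.
have [C [_ /(_ (`|C| + 1))]] := compact_bounded (continuous_compact
  (continuous_subspaceT cont) cphi).
rewrite (le_lt_trans (ler_norm C)) ?ltrDl // => /(_ isT) CP.
pose B := [set x : 'rV[R]_d | forall i, `|x ord0 i| <= M].
have LB : L2 Omega (\1_B).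
  by apply: L2_indic; [exact: measurable_rV_box|exact: lebesgue_rV_box_lty].
apply: (L2_dominated mO LB (c := `|C| + 1)) => //.
  by apply: measurable_funTS; exact: continuous_measurable_rV.
move=> x _; have [->|phix] := eqVneq (phi x) 0.
  by rewrite normr0 mulr_ge0 ?addr_ge0.
have Kx : closure [set x | phi x != 0] x by exact: subset_closure.
have Bx : x \in B by apply/mem_set/KM.
rewrite indicE Bx normr1 mulr1; apply: CP.
by exists x.
Qed.

End test_functions.

(** * Weak derivatives and Green's identity *)

Section green.
Variables (R : realType) (d : nat) (Omega : set 'rV[R]_d).
Hypothesis mO : measurable Omega.
Implicit Types f g u v w z phi : 'rV[R]_d -> R.
Local Notation mu := (@lebesgue_rV R d).
Local Notation L2 := (L2 Omega).
Local Notation ip f g := (\int[mu]_(x in Omega) (f x * g x)).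
Local Notation D := (weak_partial Omega).

Lemma ipC f g : ip f g = ip g f.
Proof. by apply: eq_Rintegral => x _; rewrite mulrC. Qed.

Lemma ip_fineK f g : L2 f -> L2 g ->
  (\int[mu]_(x in Omega) (f x * g x)%:E)%E = (ip f g)%:E.
Proof.
by move=> Lf Lg; rewrite fineK //; apply: integrable_fin_num => //; exact: L2M_integrable.
Qed.

Lemma ip_lincomb (a b : R) f g h : L2 f -> L2 g -> L2 h ->
  ip h (fun x => a * f x + b * g x) = a * ip h f + b * ip h g.
Proof.
move=> Lf Lg Lh.
have If := L2M_integrable mO Lh Lf; have Ig := L2M_integrable mO Lh Lg.
rewrite -!RintegralZl // -RintegralD //; last 2 first.
  exact: (integrableZl mO a If).
  exact: (integrableZl mO b Ig).
by apply: eq_Rintegral => x _; ring.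
Qed.

Lemma ip_sum (I : Type) (r : seq I) f (g : I -> 'rV[R]_d -> R) :
  L2 f -> (forall i, L2 (g i)) ->
  ip f (fun x => \sum_(i <- r) g i x) = \sum_(i <- r) ip f (g i).
Proof.
move=> Lf Lg; rewrite -Rintegral_sum // => [|i]; last exact: L2M_integrable.
by apply: eq_Rintegral => x _; rewrite mulr_sumr.
Qed.

Lemma is_weak_partialP i f g : L2 f -> L2 g ->
  is_weak_partial Omega i f g <->
  forall phi, test_function Omega phi -> ip f (partial i phi) = - ip g phi.
Proof.
move=> Lf Lg; split=> h phi tphi; have := h _ tphi;
  rewrite !ip_fineK ?(test_function_L2 mO) //;
  try (by apply: test_function_L2 => //; exact: test_function_partial).
  by case.
by move=> ->; rewrite EFinN.
Qed.

Lemma H1_L2 u : H1 Omega u -> L2 u.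
Proof. by case. Qed.

Lemma weak_partial_spec i u : H1 Omega u ->
  L2 (D i u) /\ is_weak_partial Omega i u (D i u).
Proof.
move=> [_ /(_ i)[g Lg ug]].
exact: (xgetPex (cst 0) (ex_intro
  (fun g => L2 g /\ is_weak_partial Omega i u g) g (conj Lg ug))).
Qed.

Lemma L2_weak_partial i u : H1 Omega u -> L2 (D i u).
Proof. by move=> /(weak_partial_spec i)[]. Qed.

Lemma is_weak_partial_lincomb i (a b : R) f g f' g' :
  L2 f -> L2 g -> L2 f' -> L2 g' ->
  is_weak_partial Omega i f f' -> is_weak_partial Omega i g g' ->
  is_weak_partial Omega i (fun x => a * f x + b * g x)
    (fun x => a * f' x + b * g' x).
Proof.
move=> Lf Lg Lf' Lg' /(is_weak_partialP _ Lf Lf') ff'.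
move=> /(is_weak_partialP _ Lg Lg') gg'.
apply/is_weak_partialP; [exact: L2_lincomb..|] => phi tphi.
have Lp := test_function_L2 mO tphi.
have Ldp := test_function_L2 mO (test_function_partial i tphi).
rewrite ipC ip_lincomb // (ipC _ f) (ipC _ g) ff' // gg' //.
by rewrite [in RHS]ipC ip_lincomb // !(ipC phi); ring.
Qed.

Lemma H1_lincomb (a b : R) u v : H1 Omega u -> H1 Omega v ->
  H1 Omega (fun x => a * u x + b * v x).
Proof.
move=> Hu Hv; have [Lu _] := Hu; have [Lv _] := Hv.
split=> [|i]; first exact: L2_lincomb.
have [Ldu du] := weak_partial_spec i Hu; have [Ldv dv] := weak_partial_spec i Hv.
exists (fun x => a * D i u x + b * D i v x); first exact: L2_lincomb.
exact: is_weak_partial_lincomb.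
Qed.

(* Weak partial derivatives are tested here against limits of test functions
   only, so their almost everywhere uniqueness is not needed. *)
Lemma ip_weak_partial_eq i u v g h : H10 Omega u -> L2 v -> L2 g -> L2 h ->
  is_weak_partial Omega i v g -> is_weak_partial Omega i v h ->
  ip (D i u) g = ip (D i u) h.
Proof.
move=> [Hu [phi [tphi _ /(_ i) cphi]]] Lv Lg Lh /(is_weak_partialP _ Lv Lg) vg
  /(is_weak_partialP _ Lv Lh) vh.
have tp k := test_function_partial i (tphi k).
have Lp k := test_function_L2 mO (tp k).
have Lu := L2_weak_partial i Hu.
have cg := L2_cvg_Rintegral mO Lp Lu Lg cphi.
have ch := L2_cvg_Rintegral mO Lp Lu Lh cphi.
have E : (fun k => ip (partial i (phi k)) g) = (fun k => ip (partial i (phi k)) h).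
  by apply/funext => k; apply: oppr_inj; rewrite ipC -vg // vh // ipC.
by rewrite E in cg; apply: cvg_unique cg ch.
Qed.

(** [weak_partial] picks one weak derivative and need not be pointwise linear; integrated against
    [D i u] with [u] in H^1_0, all L^2 weak derivatives of a function give the same value. *)
Lemma ip_weak_partial_lincomb i (a b : R) u f g :
  H10 Omega u -> H1 Omega f -> H1 Omega g ->
  ip (D i u) (D i (fun x => a * f x + b * g x)) =
  a * ip (D i u) (D i f) + b * ip (D i u) (D i g).
Proof.
move=> Hu Hf Hg.
have [Ldf df] := weak_partial_spec i Hf; have [Ldg dg] := weak_partial_spec i Hg.
have Hfg := H1_lincomb a b Hf Hg.
have [Ldfg dfg] := weak_partial_spec i Hfg.
have [Lf Lg] := (H1_L2 Hf, H1_L2 Hg).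
have LDu : L2 (D i u) by apply: L2_weak_partial; case: Hu.
rewrite -(ip_lincomb a b Ldf Ldg LDu).
apply: (ip_weak_partial_eq Hu (H1_L2 Hfg)) => //.
  exact: L2_lincomb.
exact: is_weak_partial_lincomb.
Qed.

(** In each term of the distributional Laplacian one derivative is moved to [u], with d_i phi as the
    test function. *)
Lemma green_test u w phi : H1 Omega u -> is_weak_laplacian Omega u w ->
  test_function Omega phi ->
  ip w phi = - \sum_(i < d) ip (D i u) (partial i phi).
Proof.
move=> Hu [Lw uw] tphi; have Lu := H1_L2 Hu.
have tdd i := test_function_partial i (test_function_partial i tphi).
rewrite -sumrN; have := uw _ tphi.
rewrite (ip_fineK Lw (test_function_L2 mO tphi)) => /(congr1 fine) /= <-.
rewrite -[fine _]/(ip u (laplacian phi)) ip_sum //; last first.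
  by move=> i; exact: test_function_L2.
apply: eq_bigr => i _; have [Ldu /is_weak_partialP] := weak_partial_spec i Hu.
by move=> /(_ Lu Ldu) ->//; exact: test_function_partial.
Qed.

(** A predicate on [v], so that it passes by linearity from the iterates in H^1_0 to their
    extrapolation, for which only H^1 is established. *)
Definition green_identity u w v :=
  ip w v = - \sum_(i < d) ip (D i u) (D i v).

Lemma H10_green u w z : H1 Omega u -> is_weak_laplacian Omega u w ->
  H10 Omega z -> green_identity u w z.
Proof.
move=> Hu uw [Hz [phi [tphi cphi cdphi]]].
have Lw := uw.1; have Lz := H1_L2 Hz.
have Lp k := test_function_L2 mO (tphi k).
have := L2_cvg_Rintegral mO Lp Lz Lw cphi.
rewrite (_ : (fun _ => _) =
    fun k => - \sum_(i < d) ip (partial i (phi k)) (D i u)); last first.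
  apply/funext => k; rewrite ipC (green_test Hu uw) //; congr (- _).
  by apply: eq_bigr => i _; rewrite ipC.
rewrite /green_identity ipC => /cvg_unique; apply => //.
apply: cvgN; apply: cvg_big => [|i _]; first exact: add_continuous.
rewrite [ip (D i u) _]ipC.
apply: L2_cvg_Rintegral => //; last 2 first.
  exact: L2_weak_partial.
  exact: L2_weak_partial.
by move=> k; apply: test_function_L2 => //; exact: test_function_partial.
Qed.

Lemma green_lincomb (a b : R) u w f g : H10 Omega u -> L2 w ->
  H1 Omega f -> H1 Omega g ->
  green_identity u w f -> green_identity u w g ->
  green_identity u w (fun x => a * f x + b * g x).
Proof.
move=> Hu Lw Hf Hg Gf Gg.
rewrite /green_identity (ip_lincomb a b (H1_L2 Hf) (H1_L2 Hg) Lw).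
rewrite Gf Gg !mulrN -opprD !mulr_sumr -big_split; congr (- _).
by apply: eq_bigr => i _; rewrite ip_weak_partial_lincomb.
Qed.

End green.

(** * Energy comparison *)

Section energy_comparison.
Variables (R : realType) (d : nat) (Omega : set 'rV[R]_d) (kappa : R).
Hypothesis mO : measurable Omega.
Implicit Types u v w : 'rV[R]_d -> R.
Local Notation mu := (@lebesgue_rV R d).
Local Notation ip f g := (\int[mu]_(x in Omega) (f x * g x)).
Local Notation D := (weak_partial Omega).

Definition energy_density u (x : 'rV[R]_d) : R :=
  kappa ^+ 2 / 2 * (\sum_(i < d) D i u x ^+ 2)
  + 1 / 4 * (1 - u x ^+ 2) ^+ 2.

Lemma energy_density_ge0 u x : 0 <= energy_density u x.
Proof.
by rewrite addr_ge0 // mulr_ge0 ?divr_ge0 ?sqr_ge0 ?sumr_ge0 // => i _; exact: sqr_ge0.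
Qed.

Lemma measurable_energy_density u : H1 Omega u ->
  measurable_fun Omega (energy_density u).
Proof.
move=> Hu; have mu_ := L2_measurable mO (H1_L2 Hu).
apply: measurable_funD; apply: measurable_funM => //.
  apply: measurable_sum => i; apply: measurable_funX.
  by apply: (L2_measurable mO); exact: L2_weak_partial.
by apply: measurable_funX; apply: measurable_funB => //; exact: measurable_funX.
Qed.

(** The function [h] dominates the energy density of [u] almost everywhere. Green's identity for [u]
    and for [v] makes the integral of [s + t] vanish, so [h] integrates to the energy of [v]. *)
Lemma energy_le u v w : H10 Omega u -> is_weak_laplacian Omega u w ->
  H1 Omega v -> green_identity Omega u w v ->
  {ae mu, forall x, Omega x ->
    1 / 4 * (1 - u x ^+ 2) ^+ 2 - 1 / 4 * (1 - v x ^+ 2) ^+ 2 <=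
    kappa ^+ 2 * (w x * (u x - v x))} ->
  (energy Omega kappa u <= energy Omega kappa v)%E.
Proof.
move=> Hu uw Hv Gv Fuv; have [Hu1 _] := Hu; have [Lw _] := uw.
have [Lu Lv] := (H1_L2 Hu1, H1_L2 Hv).
have LDu i := L2_weak_partial i Hu1; have LDv i := L2_weak_partial i Hv.
have Gu := H10_green mO Hu1 uw Hu.
(* If the energy of [v] is infinite the claim is trivial; otherwise its density is integrable. *)
have [voo|] := boolP (energy Omega kappa v < +oo)%E; last first.
  by rewrite -leNgt leye_eq => /eqP ->; rewrite leey.
pose s x := w x * (1 * u x + (-1) * v x).
pose t x := \sum_(i < d) D i u x * (1 * D i u x + (-1) * D i v x).
pose h x := energy_density v x + kappa ^+ 2 * (s x + t x).
have Is : mu.-integrable Omega (EFin \o s).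
  by apply: L2M_integrable => //; exact: L2_lincomb.
have It_ i : mu.-integrable Omega (EFin \o
    (fun x => D i u x * (1 * D i u x + (-1) * D i v x))).
  by apply: L2M_integrable => //; exact: L2_lincomb.
have It : mu.-integrable Omega (EFin \o t). by exact: integrable_sum_EFin.
have st0 : \int[mu]_(x in Omega) (s x + t x) = 0.
  have -> : \int[mu]_(x in Omega) (s x + t x) =
      \int[mu]_(x in Omega) s x + \int[mu]_(x in Omega) t x by exact: RintegralD.
  have -> : \int[mu]_(x in Omega) s x = ip w u - ip w v.
    by rewrite /s (ip_lincomb mO 1 (-1) Lu Lv Lw) mul1r mulN1r.
  have -> : \int[mu]_(x in Omega) t x =
      \sum_(i < d) (ip (D i u) (D i u) - ip (D i u) (D i v)).
    rewrite Rintegral_sum //; apply: eq_bigr => i _.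
    by rewrite (ip_lincomb mO 1 (-1) (LDu i) (LDv i) (LDu i)) mul1r mulN1r.
  by rewrite sumrB Gu Gv opprK addrACA subrr addr0 addNr.
have mv := measurable_energy_density Hv.
have Iv : mu.-integrable Omega (EFin \o energy_density v).
  apply/integrableP; split; first exact/measurable_EFinP.
  under eq_integral do rewrite /= ger0_norm ?energy_density_ge0 //.
  exact: voo.
have Ist : mu.-integrable Omega (EFin \o (fun x => s x + t x)).
  exact: (integrableD mO Is It).
have Ih : mu.-integrable Omega (EFin \o h).
  exact: (integrableD mO Iv (integrableZl mO (kappa ^+ 2) Ist)).
have inth : (\int[mu]_(x in Omega) (h x)%:E)%E = energy Omega kappa v.
  transitivity (\int[mu]_(x in Omega) (energy_density v x)%:E +
      \int[mu]_(x in Omega) ((kappa ^+ 2)%:E * (s x + t x)%:E))%E.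
    exact: (integralD mO Iv (integrableZl mO (kappa ^+ 2) Ist)).
  rewrite integralZl // -[X in (_ * X)%E]fineK; last exact: integrable_fin_num.
  by rewrite -[fine _]/(\int[mu]_(x in Omega) (s x + t x)) st0 mule0 adde0.
have uh : {ae mu, forall x, Omega x -> energy_density u x <= h x}.
  apply: filterS Fuv => x /[apply] Fx; rewrite /h /energy_density /s.
  (* Termwise, 2a(a - b) - (a^2 - b^2) = (a - b)^2. *)
  have : \sum_(i < d) D i u x ^+ 2 - \sum_(i < d) D i v x ^+ 2 <= 2 * t x.
    rewrite -sumrB mulr_sumr; apply: ler_sum => i _.
    have := sqr_ge0 (D i u x - D i v x); nra.
  have := sqr_ge0 kappa; move: Fx.
  move: (t x) (\sum_(i < d) _) (\sum_(i < d) _) (kappa ^+ 2) => tx su sv k Fx k0 le.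
  have := ler_wpM2l k0 le; nra.
have mh : measurable_fun Omega h by apply/measurable_EFinP; exact: measurable_int Ih.
(* [h] is known to be nonnegative only almost everywhere, so its absolute value enters the
   comparison of nonnegative integrals. *)
rewrite -inth (ae_eq_integral (fun x => (`|h x|)%:E)) //.
- apply: ae_ge0_le_integral => //.
  + by move=> x _; rewrite lee_fin energy_density_ge0.
  + by apply/measurable_EFinP; exact: measurable_energy_density.
  + by apply/measurable_EFinP; exact: measurableT_comp.
  + apply: filterS uh => x /[apply] ux; rewrite lee_fin.
    by apply: le_trans ux _; exact: ler_norm.
- exact/measurable_EFinP.
- by apply/measurable_EFinP; exact: measurableT_comp.
- apply: filterS uh => x /[apply] ux; congr EFin => /=.
  by rewrite ger0_norm // (le_trans _ ux) // energy_density_ge0.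
Qed.

End energy_comparison.

(** * Convolution quadrature weights *)

Section convolution_weights.
Variables (R : realType) (alpha : R).
Local Notation omega := (cq_weight alpha).

Lemma cq_weight0 : omega 0 = 1.
Proof. by rewrite /cq_weight big_ord0 fact0 !mul1r invr1. Qed.

Lemma cq_weightS j : omega j.+1 = omega j * ((j%:R - alpha) / j.+1%:R).
Proof.
rewrite /cq_weight big_ord_recr /= exprS factS natrM.
have h1 : j%:R + 1 != 0 :> R by rewrite natr1 pnatr_eq0.
have h2 : j`!%:R != 0 :> R by rewrite pnatr_eq0 -lt0n fact_gt0.
rewrite -natr1; move: (j%:R) (j`!%:R) (\prod_(_ < _) _) h1 h2 => a b c h1 h2.
by field; rewrite h1 h2.
Qed.

(** The weights are the Taylor coefficients of (1 - z)^alpha. By this relation, adding the next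
    weight multiplies the partial sum by 1 - alpha/(j+1), which yields the signs of the sums and of
    the weights. *)
Lemma cq_weightS_sum j :
  omega j.+1 = - (alpha / j.+1%:R) * \sum_(k < j.+1) omega k.
Proof.
elim: j => [|j IH].
  by rewrite big_ord1 cq_weightS cq_weight0; field.
rewrite big_ord_recr /= mulrDr cq_weightS.
have h1 : j.+1%:R != 0 :> R by rewrite pnatr_eq0.
have h2 : j.+1%:R + 1 != 0 :> R by rewrite natr1 pnatr_eq0.
rewrite -[j.+2%:R]natr1 IH; move: (j.+1%:R) (\sum_(_ < _) _) h1 h2 => c P h1 h2.
by field; rewrite h1 h2.
Qed.

Hypothesis alpha01 : 0 < alpha < 1.

Lemma cq_weight_sum_ge0 j : 0 <= \sum_(k < j.+1) omega k.
Proof.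
have /andP[a0 a1] := alpha01.
elim: j => [|j IH]; first by rewrite big_ord1 cq_weight0.
rewrite big_ord_recr /= cq_weightS_sum.
rewrite -[X in X + _]mul1r -mulrDl mulr_ge0 // subr_ge0.
rewrite ler_pdivrMr // mul1r (le_trans (ltW a1)) // ler1n //.
Qed.

Lemma cq_weight_le0 j : omega j.+1 <= 0.
Proof.
have /andP[a0 a1] := alpha01.
rewrite cq_weightS_sum mulNr oppr_le0 mulr_ge0 ?cq_weight_sum_ge0 //.
by rewrite divr_ge0 // ltW.
Qed.

(* extrapolation is the convex combination of the previous iterates with
   weights - omega_(n-j) for 1 <= j < n and sum_(k < n) omega_k for j = 0 *)
Lemma convex_extrapolation_bound n (y : nat -> R) :
  (forall j, (j < n.+1)%N -> `|y j| <= 1) ->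
  `|y 0%N - \sum_(1 <= j < n.+1) omega (n.+1 - j) * (y j - y 0%N)| <= 1.
Proof.
move=> yb; pose c j := - omega (n.+1 - j).
have c0 j : (1 <= j < n.+1)%N -> 0 <= c j.
  by move=> /andP[_ jn]; rewrite oppr_ge0 subSn // cq_weight_le0.
(* After reversal the sum runs over omega_1, ..., omega_n; as omega_0 = 1, the [c j] add up to 1
   minus a nonnegative partial sum. *)
have sumc : \sum_(1 <= j < n.+1) c j <= 1.
  rewrite sumrN lerNl -subr_ge0 opprK addrC.
  have := cq_weight_sum_ge0 n.
  rewrite -(big_mkord xpredT) big_ltn // cq_weight0 [X in _ + X]big_nat_rev /=.
  by under eq_bigr do rewrite add1n subSS.
have -> : y 0%N - \sum_(1 <= j < n.+1) omega (n.+1 - j) * (y j - y 0%N) =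
    (1 - \sum_(1 <= j < n.+1) c j) * y 0%N + \sum_(1 <= j < n.+1) c j * y j.
  have -> : \sum_(1 <= j < n.+1) omega (n.+1 - j) * (y j - y 0%N) =
      (\sum_(1 <= j < n.+1) c j) * y 0%N - \sum_(1 <= j < n.+1) c j * y j.
    by rewrite mulr_suml -sumrB; apply: eq_bigr => j _; rewrite /c; ring.
  by rewrite mulrBl mul1r opprB addrA addrAC.
apply: (le_trans (ler_normD _ _)).
rewrite -[leRHS](subrK (\sum_(1 <= j < n.+1) c j)); apply: lerD.
  by rewrite normrM ger0_norm ?subr_ge0 // ler_piMr ?subr_ge0 // yb.
apply: (le_trans (ler_norm_sum _ _ _)); apply: ler_sum_nat => j jn.
rewrite normrM ger0_norm ?c0 // ler_piMr ?c0 // yb //.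
by case/andP: jn.
Qed.

(** Since omega_0 = 1, the last term of the quadrature cancels u_(n+1) and leaves earlier iterates
    only. *)
Lemma extrapolationE d tau (u : nat -> 'rV[R]_d -> R) n x : 0 < tau ->
  extrapolation alpha tau u n.+1 x =
  u 0%N x - \sum_(1 <= j < n.+1) omega (n.+1 - j) * (u j x - u 0%N x).
Proof.
move=> tau0; rewrite /extrapolation /cq mulrA -powRD; last first.
  by apply/implyP => _; rewrite gt_eqF.
rewrite subrr powRr0 mul1r big_nat_recr //= subnn cq_weight0 mul1r.
by set a := \sum_(_ <= _ < _) _; ring.
Qed.

Lemma cqE d tau (u : nat -> 'rV[R]_d -> R) n x : 0 < tau ->
  cq alpha tau u n x = tau `^ (- alpha) * (u n x - extrapolation alpha tau u n x).
Proof.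
move=> tau0; rewrite /extrapolation opprB addrCA subrr addr0.
rewrite mulrA -powRD ?addNr ?powRr0 ?mul1r //.
by apply/implyP => _; rewrite gt_eqF.
Qed.

End convolution_weights.

(** * The weak maximum principle *)

Section ae_monotonicity.
Context d (T : measurableType d) (R : realType) (mu : {measure set T -> \bar R}).

Lemma ae_le_Rintegral (A : set T) (f g : T -> R) : measurable A ->
  mu.-integrable A (EFin \o f) -> mu.-integrable A (EFin \o g) ->
  {ae mu, forall x, A x -> f x <= g x} ->
  \int[mu]_(x in A) f x <= \int[mu]_(x in A) g x.
Proof.
move=> mA If Ig fg; rewrite -subr_ge0 -RintegralB //.
have Igf := integrableB mA Ig If.
have mgf : measurable_fun A (fun x => g x - f x).
  by apply/measurable_EFinP; exact: measurable_int Igf.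
(* The difference is nonnegative only almost everywhere; its absolute value is so everywhere. *)
have -> : \int[mu]_(x in A) (g x - f x) = \int[mu]_(x in A) `|g x - f x|.
  congr fine; apply: ae_eq_integral => //.
  - exact/measurable_EFinP.
  - by apply/measurable_EFinP; exact: measurableT_comp.
  - by apply: filterS fg => x /[apply] fgx; rewrite ger0_norm // subr_ge0.
exact: Rintegral_ge0.
Qed.

End ae_monotonicity.

(** * Pointwise estimates for the truncations *)

Section cutoff_estimates.
Variable R : realType.
Implicit Types a s : R.

(** In 1 - a^(n+1) = (1 - a)(1 + a + ... + a^n) each of the n+1 powers is at least a^n. *)
Lemma bernoulli_bound n a : 0 <= a <= 1 ->
  n.+1%:R * ((1 - a) * a ^+ n) <= 1 - a ^+ n.+1.
Proof.
move=> /andP[a0 a1]; elim: n => [|n IH]; first by rewrite expr0 expr1; lra.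
have an1 : a ^+ n.+1 <= 1 by rewrite exprn_ile1.
have := ler_wpM2l a0 IH; rewrite -[n.+2%:R]natr1 [a ^+ n.+2]exprS => h.
have -> : (n.+1%:R + 1) * ((1 - a) * a ^+ n.+1) =
    a * (n.+1%:R * ((1 - a) * a ^+ n)) + (1 - a) * a ^+ n.+1 by rewrite !exprS; ring.
move: an1 h; move: (a ^+ n.+1) (a * (n.+1%:R * _)) => p q p1 h; nra.
Qed.

(** For a >= 1 the quotient is at least 1/2; for a < 1 the maximum is 0 and the Bernoulli bound
    controls the loss. The error is a multiple of a^2 rather than a constant, so it is integrable at
    a = |u| even over a domain of infinite measure. *)
Lemma cutoff_lower_bound k a : 0 <= a ->
  2^-1 * (a * Num.max (a - 1) 0) - k.+1%:R^-1 * a ^+ 2 <=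
  a * (a - 1) * (a ^+ k.+1.*2 / (1 + a ^+ k.+1.*2)).
Proof.
move=> a0; have q1 := even_exp1_gt0 k.+1 a.
have k0 : 0 <= k.+1%:R^-1 * a ^+ 2 :> R by rewrite mulr_ge0 // sqr_ge0.
have [a1|a1] := leP 1 a.
  rewrite max_l ?subr_ge0 //.
  have : 2^-1 <= a ^+ k.+1.*2 / (1 + a ^+ k.+1.*2).
    rewrite ler_pdivlMr //; have : 1 <= a ^+ k.+1.*2 by rewrite exprn_ege1.
    lra.
  have : 0 <= a * (a - 1) by rewrite mulr_ge0 // subr_ge0.
  move: (_ / _) (a * (a - 1)) (_^-1 * a ^+ 2) k0 => r b e k0 b0 r2.
  have := ler_wpM2l b0 r2; lra.
rewrite max_r; last by rewrite subr_le0 ltW.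
rewrite mulr0 mulr0 sub0r.
have qle : a ^+ k.+1.*2 / (1 + a ^+ k.+1.*2) <= a ^+ k.+1.*2.
  by rewrite ler_pdivrMr // ler_peMr ?even_exp_ge0 // lerDl even_exp_ge0.
(* One of the 2k+2 powers of [a] is held back; with the outer factor [a] it forms the a^2 of the
   error. *)
have : k.+1%:R * ((1 - a) * a ^+ k.*2.+1) <= 1.
  have := @bernoulli_bound k.*2.+1 a; rewrite a0 ltW // => /(_ isT) h.
  have h1 : 0 <= (1 - a) * a ^+ k.*2.+1.
    by rewrite mulr_ge0 ?exprn_ge0 // subr_ge0 ltW.
  have h2 : a ^+ k.*2.+2 >= 0 by rewrite exprn_ge0.
  have h3 : k.+1%:R <= k.*2.+2%:R :> R by rewrite ler_nat -doubleS -addnn leq_addr.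
  have := ler_wpM2r h1 h3; lra.
rewrite mulrC -ler_pdivlMr ?ltr0n // div1r => kb.
have : (1 - a) * a ^+ k.+1.*2 <= k.+1%:R^-1 * a.
  by rewrite doubleS exprSr mulrA ler_wpM2r.
have : (1 - a) * (a ^+ k.+1.*2 / (1 + a ^+ k.+1.*2)) <= (1 - a) * a ^+ k.+1.*2.
  by rewrite ler_wpM2l // subr_ge0 ltW.
move: (k.+1%:R^-1) (a ^+ k.+1.*2) (a ^+ k.+1.*2 / (1 + a ^+ k.+1.*2)) => c q r h1 h2.
have := ler_wpM2l a0 (le_trans h1 h2); lra.
Qed.

Lemma continuous_cutoff' m : continuous (@cutoff' R m).
Proof.
move=> s; have cX n : (fun t : R => t ^+ n) @ s --> s ^+ n.
  exact: exprn_continuous.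
have cD (b : R) : (fun t : R => b + t ^+ m.*2) @ s --> b + s ^+ m.*2.
  by apply: cvgD; [exact: cvg_cst|exact: cX].
apply: cvgM; first by apply: cvgM; [exact: cX|exact: cD].
apply: cvgV; first by rewrite gt_eqF // exprn_gt0 // even_exp1_gt0.
rewrite expr2; under eq_fun do rewrite expr2.
by apply: cvgM; exact: cD.
Qed.

End cutoff_estimates.

Section maximum_principle.
Variables (R : realType) (d : nat) (Omega : set 'rV[R]_d).
Hypothesis mO : measurable Omega.
Implicit Types f g u v w z phi : 'rV[R]_d -> R.
Local Notation mu := (@lebesgue_rV R d).
Local Notation L2 := (L2 Omega).
Local Notation L2_norm := (L2_norm Omega).
Local Notation ip f g := (\int[mu]_(x in Omega) (f x * g x)).
Local Notation D := (weak_partial Omega).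

Lemma L2_norm_cvg0_dominated (c : R) (f_ g_ : nat -> 'rV[R]_d -> R) : 0 <= c ->
  (forall k, L2 (g_ k)) -> (forall k, measurable_fun Omega (f_ k)) ->
  (forall k x, Omega x -> `|f_ k x| <= c * `|g_ k x|) ->
  L2_norm (g_ k) @[k --> \oo] --> 0%E -> L2_norm (f_ k) @[k --> \oo] --> 0%E.
Proof.
move=> c0 Lg mf fg cg.
apply: (@squeeze_cvge _ _ _ _ (cst 0%E) _ (fun k => c%:E * L2_norm (g_ k))%E).
- apply: nearW => k; apply/andP; split; first exact: Lnorm_ge0.
  exact: (L2_norm_le mO (Lg k) (mf k) c0 (fg k)).
- exact: cvg_cst.
- by rewrite -[0%E](mule0 c%:E); apply: cvgeZl.
Qed.

Lemma partial_cutoff m i phi x : test_function Omega phi ->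
  partial i (cutoff m \o phi) x = cutoff' m (phi x) * partial i phi x.
Proof.
move=> tphi.
have := is_derive_cutoff m (test_function_derivable (i := i) (x := x) tphi).
by case.
Qed.

Lemma L2_cutoff m u : L2 u -> L2 (cutoff m \o u).
Proof.
move=> Lu; apply: (L2_dominated mO Lu _ (c := m.*2.+1%:R)) => // [|x _].
  apply: (measurableT_comp _ (L2_measurable mO Lu)).
  by apply: continuous_measurable_fun; exact: continuous_cutoff.
by have := cutoff_lipschitz m (u x) 0; rewrite cutoff0 !subr0.
Qed.

(** Formally the left side is - int eta_m'(u) |grad u|^2. The sign is obtained along test functions
    phi_k, up to an error that vanishes in the limit. *)
Lemma ip_cutoff_le0 m u w : H10 Omega u -> is_weak_laplacian Omega u w ->
  ip w (cutoff m \o u) <= 0.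
Proof.
move=> [Hu [phi [tphi cphi cdphi]]] uw; have Lw := uw.1; have Lu := H1_L2 Hu.
have LDu i := L2_weak_partial i Hu.
have tc k := test_function_cutoff m (tphi k).
have Lc k := test_function_L2 mO (tc k).
have Lp k := test_function_L2 mO (tphi k).
have Ldp k i := test_function_L2 mO (test_function_partial i (tphi k)).
have Lcu := L2_cutoff m Lu.
have L2B f g : L2 f -> L2 g -> L2 (f \- g).
  move=> Lf Lg; rewrite (_ : _ \- _ = fun x => 1 * f x + (-1) * g x).
    exact: L2_lincomb.
  by apply/funext => x /=; rewrite mul1r mulN1r.
have cl : ip (cutoff m \o phi k) w @[k --> \oo] --> ip (cutoff m \o u) w.
  apply: L2_cvg_Rintegral => //.
  apply: (L2_norm_cvg0_dominated (c := m.*2.+1%:R) _ _ _ _ cphi) => //.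
  - by move=> k; exact: L2B.
  - by move=> k; apply: (L2_measurable mO); exact: L2B.
  - by move=> k x _; exact: cutoff_lipschitz.
(* The error of replacing d_i phi_k by d_i u in the chain rule; it tends to 0 in L^2 because
   [cutoff' m] is bounded. *)
pose f i k x := cutoff' m (phi k x) * (partial i (phi k) x - D i u x).
have mf i k : measurable_fun Omega (f i k).
  apply: measurable_funM.
    apply: (measurableT_comp _ (L2_measurable mO (Lp k))).
    by apply: continuous_measurable_fun; exact: continuous_cutoff'.
  by apply: measurable_funB; exact: L2_measurable.
have fle i k x : Omega x -> `|f i k x| <= m.*2.+1%:R * `|(partial i (phi k) \- D i u) x|.
  by move=> _; rewrite normrM ler_wpM2r // ger0_norm ?cutoff'_ge0 // cutoff'_le.
have LBp i k : L2 (partial i (phi k) \- D i u) by exact: L2B.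
have Lf i k : L2 (f i k) by apply: (L2_dominated mO (LBp i k) (mf i k)) (fle i k).
have L0 : L2 (cst 0).
  rewrite (_ : cst 0 = \1_set0); first by apply: L2_indic => //; rewrite measure0.
  by apply/funext => x; rewrite indicE in_set0.
have cf i : ip (f i k) (D i u) @[k --> \oo] --> ip (cst 0) (D i u).
  apply: L2_cvg_Rintegral => //.
  have -> : (fun k => L2_norm (f i k \- cst 0)) = (fun k => L2_norm (f i k)).
    by apply/funext => k; congr Defs.L2_norm; apply/funext => x /=; rewrite subr0.
  exact: (L2_norm_cvg0_dominated _ (LBp i) (mf i) (fle i) (cdphi i)).
have cs : - (\sum_(i < d) ip (f i k) (D i u)) @[k --> \oo] --> (0 : R).
  have s0 : - \sum_(i < d) ip (cst 0) (D i u) = 0.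
    rewrite big1 ?oppr0 // => i _; under eq_Rintegral do rewrite mul0r.
    by rewrite Rintegral_cst // mul0r.
  rewrite -[X in _ --> X]s0; apply: cvgN.
  by apply: cvg_big => [|i _]; [exact: add_continuous|exact: cf].
rewrite ipC; apply: (ler_cvg_to cl cs); apply: nearW => k.
rewrite ipC (green_test mO Hu uw (tc k)) lerN2; apply: ler_sum => i _.
rewrite ipC; apply: le_Rintegral => //.
- exact: L2M_integrable.
- apply: L2M_integrable => //.
  exact: (test_function_L2 mO (test_function_partial i (tc k))).
(* With e = eta_m'(phi_k), a = d_i u and b = d_i phi_k, this is e(b - a)a <= e b a, that is, e a^2
   >= 0. *)
move=> x _; rewrite partial_cutoff // /f.
have := cutoff'_ge0 m (phi k x); have := sqr_ge0 (D i u x).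
move: (cutoff' _ _) (D i u x) (partial _ _ _) => e a b a0 e0.
have := mulr_ge0 e0 a0; nra.
Qed.

(** [P] vanishes exactly where |u| <= 1. Testing with [cutoff n.+1 \o u] bounds the integral of P/2
    by that of u^2/(n+1) for every n, so [P] has integral 0. *)
Lemma weak_maximum_principle (c k : R) u w : 0 < c ->
  H10 Omega u -> is_weak_laplacian Omega u w ->
  {ae mu, forall x, Omega x -> `|c * u x - k ^+ 2 * w x| <= c} ->
  {ae mu, forall x, Omega x -> `|u x| <= 1}.
Proof.
move=> c0 Hu uw uwc; have Lw := uw.1; have Lu := H1_L2 Hu.1.
pose P x := `|u x| * Num.max (`|u x| - 1) 0.
have mu_ := L2_measurable mO Lu.
have P0 x : 0 <= P x by rewrite mulr_ge0 // le_max lexx orbT.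
have mP : measurable_fun Omega P.
  apply: measurable_funM; first exact: measurableT_comp.
  apply: measurable_maxr => //; apply: measurable_funB => //.
  exact: measurableT_comp.
have Iu : mu.-integrable Omega (EFin \o (fun x => u x ^+ 2)).
  exact: L2M_integrable.
have IP : mu.-integrable Omega (EFin \o P).
  apply: le_integrable Iu => //; first exact/measurable_EFinP.
  move=> x _; rewrite /= lee_fin ger0_norm ?P0 // ger0_norm ?sqr_ge0 //.
  rewrite -real_normK ?num_real // expr2 ler_wpM2l // ge_max normr_ge0 andbT.
  by rewrite gerBl.
have key n : \int[mu]_(x in Omega) (2^-1 * P x - n.+1%:R^-1 * u x ^+ 2) <= 0.
  pose e := cutoff n.+1 \o u.
  have Le : L2 e by exact: L2_cutoff.
  have I0 : mu.-integrable Omega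
      (EFin \o (fun x => 2^-1 * P x - n.+1%:R^-1 * u x ^+ 2)).
    exact: (integrableB mO (integrableZl mO 2^-1 IP) (integrableZl mO n.+1%:R^-1 Iu)).
  have Iwe := L2M_integrable mO Lw Le.
  have := ip_cutoff_le0 n.+1 Hu uw => h0.
  have h : \int[mu]_(x in Omega) (c * (2^-1 * P x - n.+1%:R^-1 * u x ^+ 2)) <=
      \int[mu]_(x in Omega) (k ^+ 2 * (w x * e x)).
    apply: ae_le_Rintegral => //.
    - exact: (integrableZl mO c I0).
    - exact: (integrableZl mO (k ^+ 2) Iwe).
    apply: filterS uwc => x /[apply]; rewrite ler_norml => /andP[W1 W2].
    have := cutoff_lower_bound n (normr_ge0 (u x)).
    have normX : `|u x| ^+ n.+1.*2 = u x ^+ n.+1.*2.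
      by rewrite -mul2n !exprM real_normK // num_real.
    rewrite normX real_normK ?num_real // -/(P x) => lb.
    have r0 : 0 <= u x ^+ n.+1.*2 / (1 + u x ^+ n.+1.*2).
      by rewrite divr_ge0 ?even_exp_ge0 // ltW // even_exp1_gt0.
    rewrite /e /= /cutoff exprS -[u x * _ / _]mulrA.
    move: (u x ^+ n.+1.*2 / (1 + u x ^+ n.+1.*2)) r0 lb => r r0 lb.
    apply: (le_trans (ler_wpM2l (ltW c0) lb)).
    (* The upper bound on c u - k^2 w is multiplied by u where u >= 0, the lower bound by -u where u
       < 0. *)
    have : c * `|u x| * (`|u x| - 1) <= k ^+ 2 * w x * u x.
      have un : `|u x| ^+ 2 = u x ^+ 2 by rewrite real_normK // num_real.
      have [u0|u0] := leP 0 (u x).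
        by have := ler_wpM2r u0 W2; rewrite ger0_norm //; lra.
      have un0 : 0 <= - u x by lra.
      by have := ler_wpM2r un0 W1; rewrite ltr0_norm //; lra.
    by move=> /(ler_wpM2r r0); lra.
  have : c * \int[mu]_(x in Omega) (2^-1 * P x - n.+1%:R^-1 * u x ^+ 2) <= 0.
    rewrite -RintegralZl //; apply: (le_trans h).
    by rewrite RintegralZl // mulr_ge0_le0 // sqr_ge0.
  by rewrite pmulr_rle0.
have P_le0 : \int[mu]_(x in Omega) P x <= 0.
  set A := \int[mu]_(x in Omega) P x.
  pose B := \int[mu]_(x in Omega) (u x ^+ 2).
  have B0 : 0 <= B by apply: Rintegral_ge0 => x _; exact: sqr_ge0.
  rewrite leNgt; apply/negP => A0.
  (* [key n] would give (n+1)A <= 2B, contradicting n > 2B/A. *)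
  pose n := Num.bound (2 * B / A).
  have Bn : 2 * B / A < n%:R by apply: archi_boundP; rewrite divr_ge0 ?mulr_ge0 // ltW.
  have := key n.
  have -> : \int[mu]_(x in Omega) (2^-1 * P x - n.+1%:R^-1 * u x ^+ 2) =
      2^-1 * A - n.+1%:R^-1 * B.
    by rewrite /A /B -!RintegralZl // -RintegralB //;
      [exact: (integrableZl mO 2^-1 IP)|exact: (integrableZl mO n.+1%:R^-1 Iu)].
  have n1 : 0 < n.+1%:R :> R by rewrite ltr0n.
  rewrite subr_le0 => /(ler_wpM2l (ltW n1)).
  rewrite [X in _ <= X]mulrA mulfV ?gt_eqF // mul1r -natr1.
  by move: Bn; rewrite ltr_pdivrMr //; lra.
have : (\int[mu]_(x in Omega) `|(P x)%:E|)%E = 0%E.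
  under eq_integral do rewrite gee0_abs ?lee_fin ?P0 //.
  rewrite -[LHS]fineK; last exact: (integrable_fin_num mO IP).
  congr EFin; apply/eqP; rewrite eq_le; apply/andP; split; first exact: P_le0.
  by apply: Rintegral_ge0 => x _; exact: P0.
move/(ae_eq_integral_abs mu mO) => /(_ ((measurable_EFinP _ _).2 mP)).
apply: filterS => x /[apply] -[].
move=> Px; rewrite leNgt; apply/negP => u1; move: Px; rewrite /P.
by apply/eqP; rewrite mulf_neq0 // gt_eqF ?lt_max ?subr_gt0 ?u1 // (lt_trans ltr01).
Qed.

End maximum_principle.

(** * The two schemes *)

Section extrapolation_regularity.
Variables (R : realType) (d : nat) (Omega : set 'rV[R]_d).
Hypothesis mO : measurable Omega.

(** Each new index adds a multiple of y_j - y0, and both conclusions are linear. The shape of [v] is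
    that of the explicit extrapolation. *)
Lemma green_affine_combination (u w y0 : 'rV[R]_d -> R)
    (y : nat -> 'rV[R]_d -> R) (c : nat -> R) (r : seq nat) :
  H10 Omega u -> is_weak_laplacian Omega u w ->
  H10 Omega y0 -> (forall j, j \in r -> H10 Omega (y j)) ->
  let v := fun x => y0 x - \sum_(j <- r) c j * (y j x - y0 x) in
  H1 Omega v /\ green_identity Omega u w v.
Proof.
move=> Hu uw Hy0; have [Hu1 _] := Hu; have [Lw _] := uw.
elim: r => [_|j r IH Hy] /=.
  rewrite (_ : (fun _ => _) = y0).
    by split; [case: Hy0|exact: H10_green].
  by apply/funext => x; rewrite big_nil subr0.
have [|Hr Gr] := IH; first by move=> i ir; apply: Hy; rewrite inE ir orbT.
have Hj : H10 Omega (y j) by apply: Hy; rewrite inE eqxx.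
have Hd := H1_lincomb mO 1 (-1) Hj.1 Hy0.1.
have Gd : green_identity Omega u w (fun x => 1 * y j x + (-1) * y0 x).
  exact: (green_lincomb mO 1 (-1) Hu Lw Hj.1 Hy0.1
    (H10_green mO Hu1 uw Hj) (H10_green mO Hu1 uw Hy0)).
rewrite (_ : (fun _ => _) = fun x =>
    1 * (y0 x - \sum_(i <- r) c i * (y i x - y0 x)) +
    (- c j) * (1 * y j x + (-1) * y0 x)).
  split; first exact: (H1_lincomb mO 1 (- c j) Hr Hd).
  exact: (green_lincomb mO 1 (- c j) Hu Lw Hr Hd Gr Gd).
by apply/funext => x; rewrite big_cons; move: (\sum_(_ <- _) _) => s; ring.
Qed.

End extrapolation_regularity.

(** * Inequalities for the double-well potential *)

Section pointwise_inequalities.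
Variable R : realType.
Implicit Types u v b c : R.

(** In F(s) = s^4/4 - s^2/2 + 1/4 the convex quartic is linearized at [u] and the concave quadratic
    at [v]; the right side is kappa^2 w (u - v), with b = tau^(-alpha). *)
Lemma wcs_pointwise b u v : 0 <= b ->
  1 / 4 * (1 - u ^+ 2) ^+ 2 - 1 / 4 * (1 - v ^+ 2) ^+ 2 <=
  (b * (u - v) - (v - u ^+ 3)) * (u - v).
Proof.
move=> b0; rewrite -subr_ge0 (_ : _ - _ =
    (u - v) ^+ 2 * (b + ((u + v) ^+ 2 + 2 * u ^+ 2) / 4 + 2^-1)); last by field.
apply: mulr_ge0; first exact: sqr_ge0.
by have := sqr_ge0 (u + v); have := sqr_ge0 u; lra.
Qed.

(** Taylor expansion of F at [v]: F'' = 3s^2 - 1 is at most 2 on [-1,1], so c >= 1 absorbs the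
    quadratic remainder. *)
Lemma lws_pointwise c u v : 1 <= c -> `|u| <= 1 -> `|v| <= 1 ->
  1 / 4 * (1 - u ^+ 2) ^+ 2 - 1 / 4 * (1 - v ^+ 2) ^+ 2 <=
  (c * (u - v) - (v - v ^+ 3)) * (u - v).
Proof.
move=> c1 u1 v1; rewrite -subr_ge0 (_ : _ - _ =
    (u - v) ^+ 2 * (c - ((u + v) ^+ 2 + 2 * v ^+ 2 - 2) / 4)); last by field.
apply: mulr_ge0; first exact: sqr_ge0.
have v2 : v ^+ 2 <= 1 by rewrite -real_normK ?num_real // exprn_ile1.
have uv2 : (u + v) ^+ 2 <= 4.
  have : `|u + v| <= 2 by apply: (le_trans (ler_normD _ _)); lra.
  by rewrite -real_normK ?num_real // => uv; have := normr_ge0 (u + v); nra.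
lra.
Qed.

(** The source has derivative c + 1 - 3v^2 >= c - 2 >= 0 on [-1,1] and equals c and -c at the
    endpoints; this is where the constant 2 of the constraint enters. *)
Lemma lws_source_bound c v : 2 <= c -> `|v| <= 1 ->
  `|c * v + (v - v ^+ 3)| <= c.
Proof.
move=> c2; rewrite !ler_norml => /andP[v0 v1].
have h1 : 0 <= (1 - v) * (c - v * (1 + v)) by apply: mulr_ge0; nra.
have h2 : 0 <= (1 + v) * (c + v * (1 - v)) by apply: mulr_ge0; nra.
apply/andP; split.
  by rewrite -subr_ge0 (_ : _ - _ = (1 + v) * (c + v * (1 - v))) //; ring.
by rewrite -subr_ge0 (_ : _ - _ = (1 - v) * (c - v * (1 + v))) //; ring.
Qed.

End pointwise_inequalities.

(** * Energy comparison and maximum principle for the iterates *)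

Section energy_stability.
Variables (R : realType) (d : nat) (Omega : set 'rV[R]_d) (alpha tau kappa : R).
Hypotheses (mO : measurable Omega) (tau0 : 0 < tau).
Variable u : nat -> 'rV[R]_d -> R.
Local Notation mu := (@lebesgue_rV R d).
Local Notation ext := (extrapolation alpha tau u).

Lemma energy_extrapolation_le n w : (forall j, (j <= n.+1)%N -> H10 Omega (u j)) ->
  is_weak_laplacian Omega (u n.+1) w ->
  {ae mu, forall x, Omega x ->
    1 / 4 * (1 - u n.+1 x ^+ 2) ^+ 2 - 1 / 4 * (1 - ext n.+1 x ^+ 2) ^+ 2 <=
    kappa ^+ 2 * w x * (u n.+1 x - ext n.+1 x)} ->
  (energy Omega kappa (u n.+1) <= energy Omega kappa (ext n.+1))%E.
Proof.
move=> Hu uw Fu.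
have extE : ext n.+1 = fun x => u 0%N x -
    \sum_(j <- index_iota 1 n.+1) cq_weight alpha (n.+1 - j) * (u j x - u 0%N x).
  by apply/funext => x; exact: extrapolationE.
have [||Hv Gv] := green_affine_combination mO (y0 := u 0%N) (y := u)
  (r := index_iota 1 n.+1) (fun j => cq_weight alpha (n.+1 - j))
  (Hu _ (leqnn _)) uw.
- exact: Hu.
- by move=> j; rewrite mem_index_iota => /andP[_ jn]; apply: Hu; exact: ltnW.
rewrite -extE in Hv Gv.
apply: (energy_le mO (Hu _ (leqnn _)) uw Hv Gv).
by apply: filterS Fu => x /[apply]; rewrite (mulrA (kappa ^+ 2)).
Qed.

(** The quantifier over [j] stands inside the almost-everywhere statement, so that all earlier
    iterates are bounded at the same point, as the convex combination requires. *)
Lemma lws_maximum_principle S N n : 0 < alpha < 1 -> 2 <= S + tau `^ (- alpha) ->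
  {ae mu, forall x, Omega x -> `|u 0%N x| <= 1} ->
  LWS alpha tau Omega kappa S N u -> (n <= N)%N ->
  {ae mu, forall x, Omega x -> forall j, (j <= n)%N -> `|u j x| <= 1}.
Proof.
move=> alpha01 c2 u01 lws; elim: n => [_|n IH nN].
  by apply: filterS u01 => x /[apply] u0x [|j].
have /IH {}IH := ltnW nN.
have [//|Hu [w uw eq_ae]] := lws n.+1.
suff : {ae mu, forall x, Omega x -> `|u n.+1 x| <= 1}.
  apply: filterS2 IH => x h1 h2 Ox j; rewrite leq_eqVlt => /predU1P[->|jn].
    exact: h2.
  exact: h1.
apply: (weak_maximum_principle mO (c := S + tau `^ (- alpha)) (k := kappa) _ Hu uw).
  by apply: lt_le_trans c2.
apply: filterS2 IH eq_ae => x h1 h2 Ox.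
have v1 : `|ext n.+1 x| <= 1.
  rewrite extrapolationE //; apply: convex_extrapolation_bound => // j jn.
  exact: h1.
have := lws_source_bound c2 v1; congr (`|_| <= _).
have := h2 Ox; rewrite cqE //.
move: (tau `^ _) (ext _ _) => b v /eqP; rewrite subr_eq => /eqP E.
(* The scheme regrouped: c u - kappa^2 w = c v + v - v^3 with c = S + tau^(-alpha). *)
rewrite (_ : kappa ^+ 2 * w x = b * (u n.+1 x - v) -
   (v - v ^+ 3 - S * (u n.+1 x - v))); last by rewrite E; ring.
by ring.
Qed.

End energy_stability.

(** The schemes constrain the iterates from index 1 on, so [hu0] supplies the regularity of index 0.
    In (b), |u0| <= 1 starts the induction of the maximum principle. *)
Theorem theorem3p4 (R : realType) (alpha T tau kappa S : R) (N d : nat)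
    (Omega : set 'rV[R]_d) (u0 : 'rV[R]_d -> R)
    (halpha : 0 < alpha < 1) (hT : 0 < T) (hN : (0 < N)%N)
    (htau : tau = T / N%:R) (hS : 0 < S) (hd : (1 <= d <= 3)%N)
    (hOmega : smooth_domain Omega) (hu0 : H10 Omega u0) :
  (forall u : nat -> 'rV[R]_d -> R,
     u 0%N = u0 -> WCS alpha tau Omega kappa N u ->
     forall n, (1 <= n <= N)%N ->
       (energy Omega kappa (u n) <=
        energy Omega kappa (extrapolation alpha tau u n))%E) /\
  (S + tau `^ (- alpha) >= 2 ->
   {ae @lebesgue_rV R d, forall x, Omega x -> `|u0 x| <= 1} ->
   forall u : nat -> 'rV[R]_d -> R,
     u 0%N = u0 -> LWS alpha tau Omega kappa S N u ->
     forall n, (1 <= n <= N)%N ->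
       (energy Omega kappa (u n) <=
        energy Omega kappa (extrapolation alpha tau u n))%E).
Proof.
have mO : measurable Omega by have [oO _ _ _] := hOmega; exact: open_measurable_rV.
have tau0 : 0 < tau by rewrite htau divr_gt0 // ltr0n.
have H10_iterates rhs u n : u 0%N = u0 ->
    solves_scheme alpha tau Omega kappa N rhs u -> (n <= N)%N ->
    forall j, (j <= n)%N -> H10 Omega (u j).
  move=> u0E uS nN [_|j jn]; first by rewrite u0E.
  by have [|//] := uS j.+1; exact: leq_trans nN.
split=> [u u0E wcs [//|n] nN|c2 u01 u u0E lws [//|n] nN].
- have [//|Hu [w uw eq_ae]] := wcs n.+1.
  apply: (energy_extrapolation_le mO tau0 _ uw).
    exact: H10_iterates u0E wcs nN.
  apply: filterS eq_ae => x /[apply]; rewrite cqE // => E.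
  rewrite (_ : kappa ^+ 2 * w x =
      tau `^ (- alpha) * (u n.+1 x - extrapolation alpha tau u n.+1 x) -
      (extrapolation alpha tau u n.+1 x - u n.+1 x ^+ 3)).
    by apply: wcs_pointwise; exact: powR_ge0.
  by rewrite -E subKr.
- have [//|Hu [w uw eq_ae]] := lws n.+1.
  apply: (energy_extrapolation_le mO tau0 _ uw).
    exact: H10_iterates u0E lws nN.
  rewrite -u0E in u01.
  have := lws_maximum_principle mO tau0 halpha c2 u01 lws nN.
  apply: filterS2 eq_ae => x E ub Ox; have := E Ox; rewrite cqE // => {}E.
  have v1 : `|extrapolation alpha tau u n.+1 x| <= 1.
    rewrite extrapolationE //; apply: convex_extrapolation_bound => // j jn.
    by apply: ub => //; exact: ltnW.
  rewrite (_ : kappa ^+ 2 * w x = (S + tau `^ (- alpha)) *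
      (u n.+1 x - extrapolation alpha tau u n.+1 x) -
      (extrapolation alpha tau u n.+1 x - extrapolation alpha tau u n.+1 x ^+ 3)).
    by apply: lws_pointwise => //; [lra|exact: ub].
  by move: E; lra.
Qed.
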